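(* Let $L_1,L_2\in\mathbb{K}[T]$ be separable $\bar q$-linearized polynomials of degree $q$ which are not both $\bar q^k$-linearized for any $k\ge2$, and let $\mathcal{X}_{(L_1,L_2)}$ be the nonsingular model of the plane curve with affine equation $L_1(X)\cdot L_2(Y)=1$. If $L_1\neq L_2$, the full automorphism group of $\mathcal{X}_{(L_1,L_2)}$ over $\mathbb{K}$ is the semidirect product $\Sigma\rtimes\Gamma$, where (a) $\Sigma=\{\tau_{\alpha,\beta}:(X,Y)\mapsto(X+\alpha,Y+\beta)\mid L_1(\alpha)=L_2(\beta)=0\}$ is an elementary abelian $p$-group of order $q^2$; (b) $\Gamma=\langle\theta\rangle$ is a cyclic group of order $\bar q-1$, where $\theta:(X,Y)\mapsto(\lambda X,\lambda^{-1}Y)$ with $\lambda$ a primitive $(\bar q-1)$-th root of unity.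
   Context: $p$ is an odd prime, $\bar q=p^n$ and $q=\bar q^m$ are powers of $p$ ($n,m\ge1$), and $\mathbb{K}$ is the algebraic closure of $\mathbb{F}_p$. For a power $r$ of $p$, a polynomial is $r$-linearized if it has the form $\sum_i a_iT^{r^i}$. Automorphisms of a curve are automorphisms of its function field fixing $\mathbb{K}$ elementwise; the maps written on $(X,Y)$ denote the automorphisms they induce on the curve.
   Formalization: The hypothesis L_1≠L_2 is replaced by: L_2(T) is not c·L_1(dT) for any nonzero c, d in K. If L_2(T)=c·L_1(dT), then (X,Y)↦(dY, X/d) is an extra automorphism outside Σ⋊Γ, so the claim fails (e.g. p=q=3, L_1=T^3+T, L_2=-L_1). *)

(* Defs.v *)
From mathcomp Require Import all_boot all_order all_algebra.
From mathcomp Require Import all_fingroup all_solvable all_field.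

Set Implicit Arguments.
Unset Strict Implicit.
Unset Printing Implicit Defensive.

Import GRing.Theory.

Local Open Scope ring_scope.

Definition linearized (K : fieldType) (r : nat) (P : {poly K}) : Prop :=
  exists (d : nat) (a : nat -> K), P = \sum_(i < d) a i *: 'X^(r ^ i).

(* L2(T) = c L1(d T) for nonzero constants c, d.  Then (X, Y) |-> (X, d Y)
   carries L1(X) L2(Y) = 1 to c L1(X) L1(Y) = 1, which is the curve of the pair
   (e L1, e L1) with e ^ 2 = c, and (X, Y) |-> (d Y, d^-1 X) is an
   automorphism of the former. *)
Definition scaling_equivalent (K : fieldType) (L1 L2 : {poly K}) : Prop :=
  exists c d : K, [/\ c != 0, d != 0 & L2 = c *: (L1 \Po (d *: 'X))].

(* An element of {poly {poly K}} is read in K[X][Y]: the inner variable is X,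
   the outer one is Y. *)
Definition curve_poly (K : fieldType) (L1 L2 : {poly K}) : {poly {poly K}} :=
  L1%:P * map_poly polyC L2 - 1.

Section FunctionField.

Variables (K F : fieldType) (iota : {rmorphism K -> F}).

Definition eval_XY (x y : F) (g : {poly {poly K}}) : F :=
  (map_poly (map_poly iota) g).[y%:P].[x].

(* F is the field of fractions of K[X,Y]/(f), with K embedded by iota and with
   x, y the classes of X, Y: the kernel of evaluation at (x, y) is (f), and
   every element of F is a quotient of values. *)
Definition is_function_field (f : {poly {poly K}}) (x y : F) : Prop :=
  (forall g, eval_XY x y g = 0 <-> exists h, g = h * f) /\
  (forall z, exists g h, eval_XY x y h != 0 /\
                         z = eval_XY x y g / eval_XY x y h).

Definition is_curve_aut (s : {rmorphism F -> F}) : Prop :=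
  bijective s /\ forall c, s (iota c) = iota c.

(* act identifies the finite group gT with the group, under composition, of
   all automorphisms of F over K.  Automorphisms are compared extensionally. *)
Definition is_full_aut_group (gT : finGroupType)
    (act : gT -> {rmorphism F -> F}) : Prop :=
  [/\ forall g, is_curve_aut (act g),
      forall s, is_curve_aut s -> exists g, act g =1 s,
      forall g h, act g =1 act h -> g = h
    & forall g h, act (g * h)%g =1 act g \o act h].

Definition is_tau (x y : F) (alpha beta : K) (s : F -> F) : Prop :=
  s x = x + iota alpha /\ s y = y + iota beta.

Definition is_theta (x y : F) (lambda : K) (s : F -> F) : Prop :=
  s x = iota lambda * x /\ s y = iota lambda^-1 * y.

End FunctionField.

(* Main.v *)
(* The curve is smooth of bidegree (q, q) in P^1 x P^1, and its holomorphic
   differentials are spanned by x^i y^j dx / L1(x) with i, j <= q - 2.  Let s be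
   an automorphism, u = s x and v = s y.  The differentials u^i v^j du / L1(u)
   are holomorphic too, so their traces to K(x) vanish.  As K(x, y) / K(x) is
   Galois, with group the translations tau of y by the roots of L2, this says
   that the q points (tau u, tau v) fail to impose independent conditions on
   polynomials of bidegree (q - 2, q - 2).  Such points lie on a line of one of
   the two rulings, so u or v is fixed by every tau and belongs to K(x).  Using
   this for s and its inverse, and with x and y exchanged, s preserves or swaps
   K(x) and K(y), so it acts by two Moebius transformations, and comparing
   coefficients in L1(X) L2(Y) = 1 shows that these are affine. *)

From HB Require Import structures.
Require Import Defs.
From mathcomp Require Import all_boot all_order all_algebra.
From mathcomp Require Import all_fingroup all_solvable all_field.
From mathcomp Require Import ring zify.

Import GRing.Theory.
Local Open Scope ring_scope.

Set Implicit Arguments.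
Unset Strict Implicit.
Unset Printing Implicit Defensive.

(** Holomorphy is tested in one subring [O] of [F] at a time, after division by [dx / L1(x)]: for a
    derivation [D] proportional to [L1(x) d/dx], the differential [u^i v^j du / L1(u)] becomes the
    function [u^i v^j D u L2(v)]. The derivatives of [L1] and [L2] are constant, so [D] is also
    proportional to [L2(y) d/dy] and the two coordinates play the same role. Regularity of [D] reads
    [D z] in [e O] for [z] in [O], with [e = 1] at affine points and [e = y^(q-2)] at poles of [y].
    The bound on [u^i v^j D u L2(v)] follows from this and from [L1(u) L2(v) = 1] alone; it
    therefore holds for the image of [(x, y)] under any automorphism, and for all its conjugates,
    without knowing how points are moved. A further obstacle is the characteristic: the trace of an
    element of K(x) is [q] times it, hence 0. Membership in K(x) is detected through [y^(q-1)]
    instead, whose trace is a nonzero constant. At the end, scaling inequivalence excludes the swap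
    of the two rulings, and [hmax] forces the slope [a] of an affine automorphism to satisfy
    [a ^+ qbar = a]. *)

Lemma mul_eq1_neq0 (F : fieldType) (a b : F) : a * b = 1 -> a != 0 /\ b != 0.
Proof. by move=> ab; apply/andP; rewrite -negb_or -mulf_eq0 ab oner_neq0. Qed.

(** * Evaluation and the function field *)

Section Evaluation.
Variables (K F : fieldType) (iota : {rmorphism K -> F}) (u v : F).

Definition eval_rmorph : {poly {poly K}} -> F :=
  horner_eval u \o (horner_eval v%:P \o map_poly (map_poly iota)).

HB.instance Definition _ := GRing.RMorphism.on eval_rmorph.

Lemma eval_rmorphE : eval_XY iota u v =1 eval_rmorph.
Proof. by []. Qed.

Lemma eval0 : eval_XY iota u v 0 = 0.
Proof. by rewrite eval_rmorphE rmorph0. Qed.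

Lemma eval1 : eval_XY iota u v 1 = 1.
Proof. by rewrite eval_rmorphE rmorph1. Qed.

Lemma evalD : {morph eval_XY iota u v : G H / G + H}.
Proof. by move=> G H; rewrite !eval_rmorphE rmorphD. Qed.

Lemma evalB : {morph eval_XY iota u v : G H / G - H}.
Proof. by move=> G H; rewrite !eval_rmorphE rmorphB. Qed.

Lemma evalM : {morph eval_XY iota u v : G H / G * H}.
Proof. by move=> G H; rewrite !eval_rmorphE rmorphM. Qed.

Lemma evalXn n : {morph eval_XY iota u v : G / G ^+ n}.
Proof. by move=> G; rewrite !eval_rmorphE rmorphXn. Qed.

Lemma evalC c : eval_XY iota u v c%:P = (map_poly iota c).[u].
Proof. by rewrite /eval_XY map_polyC hornerC. Qed.

Lemma evalY : eval_XY iota u v 'X = v.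
Proof. by rewrite /eval_XY map_polyX hornerX hornerC. Qed.

Lemma evalX : eval_XY iota u v ('X%:P) = u.
Proof. by rewrite evalC map_polyX hornerX. Qed.

Lemma eval_map_polyC P : eval_XY iota u v (map_poly polyC P) = (map_poly iota P).[v].
Proof.
elim/poly_ind: P => [|P c IH]; first by rewrite !rmorph0 horner0 eval0.
rewrite !(rmorphD, rmorphM) /= !map_polyX !map_polyC /= hornerMXaddC -IH.
by rewrite evalD evalM evalY evalC map_polyC hornerC.
Qed.

Lemma eval_curve (L1 L2 : {poly K}) :
  eval_XY iota u v (curve_poly L1 L2) =
    (map_poly iota L1).[u] * (map_poly iota L2).[v] - 1.
Proof.
by rewrite /curve_poly evalB evalM eval1 evalC eval_map_polyC.
Qed.

Lemma eval_closed (S : F -> Prop) :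
    (forall c, S (iota c)) -> S u -> S v ->
    (forall a b, S a -> S b -> S (a + b)) ->
    (forall a b, S a -> S b -> S (a * b)) ->
  forall G, S (eval_XY iota u v G).
Proof.
move=> SK Su Sv SD SM; elim/poly_ind => [|G c IH].
  by rewrite eval0 -(rmorph0 iota); apply: SK.
rewrite evalD evalM evalY evalC.
apply: (SD); first exact: SM.
elim/poly_ind: c => [|c k IHc]; first by rewrite rmorph0 horner0 -(rmorph0 iota).
rewrite rmorphD rmorphM /= map_polyX map_polyC hornerMXaddC.
by apply: SD; [apply: SM | apply: SK].
Qed.

End Evaluation.

Lemma eval_swap (K F : fieldType) (iota : {rmorphism K -> F}) (u v : F) G :
  eval_XY iota u v (swapXY G) = eval_XY iota v u G.
Proof. by rewrite /eval_XY -swapXY_map horner2_swapXY. Qed.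

(** Additivity is asked over every extension of scalars because it is applied in [K], in [F], and in
    [{poly K}], where evaluation is composition. *)
Definition additive_poly (K : fieldType) (L : {poly K}) :=
  forall (R : comNzRingType) (f : {rmorphism K -> R}) (a b : R),
    (map_poly f L).[a + b] = (map_poly f L).[a] + (map_poly f L).[b].

(** What the geometry needs from a separable linearized polynomial of degree [q]. The nonzero
    constant derivative makes [L1(x) d/dx] and [L2(y) d/dy] proportional on the curve, with a
    constant ratio. *)
Record lin_poly (K : fieldType) (q : nat) (L : {poly K}) : Prop := LinPoly {
  lin_add : additive_poly L;
  lin_size : size L = q.+1;
  lin_deriv : L^`() = (L`_1)%:P;
  lin_coef1 : L`_1 != 0 }.

Record curve (K : closedFieldType) (F : fieldType) (iota : {rmorphism K -> F})
  (q : nat) (L1 L2 : {poly K}) (x y : F) : Prop := Curve {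
  curve_q : (2 < q)%N;
  curve_lin1 : lin_poly q L1;
  curve_lin2 : lin_poly q L2;
  curve_ff : is_function_field iota (curve_poly L1 L2) x y }.

Lemma curve_swap (K : closedFieldType) (F : fieldType)
    (iota : {rmorphism K -> F}) q L1 L2 x y :
  curve iota q L1 L2 x y -> curve iota q L2 L1 y x.
Proof.
case=> hq l1 l2 [ker frac]; split=> //.
have sw : swapXY (curve_poly L1 L2) = curve_poly L2 L1.
  rewrite /curve_poly swapXY_is_zmod_morphism rmorph1 rmorphM /=.
  by rewrite swapXY_polyC swapXY_map_polyC mulrC.
split=> [g|z].
  rewrite -[g]swapXYK eval_swap; split=> [/ker [h ->]|[h]].
    by exists (swapXY h); rewrite rmorphM /= sw.
  by rewrite swapXYK => ->; apply/ker; exists (swapXY h); rewrite rmorphM -sw /= swapXYK.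
have [g [h [h0 ->]]] := frac z.
by exists (swapXY g), (swapXY h); rewrite !eval_swap.
Qed.

Section LinPoly.
Variables (K : fieldType) (q : nat) (L : {poly K}).
Hypothesis hL : lin_poly q L.

Lemma lin_neq0 : L != 0.
Proof. by rewrite -size_poly_eq0 (lin_size hL). Qed.

Lemma lin_lead : L`_q != 0.
Proof.
have := lead_coef_eq0 L; rewrite lead_coefE (lin_size hL) /= => ->.
exact: lin_neq0.
Qed.

Lemma lin_addF (F : fieldType) (f : {rmorphism K -> F}) (a b : F) :
   (map_poly f L).[a + b] = (map_poly f L).[a] + (map_poly f L).[b].
Proof. exact: (lin_add hL). Qed.

Lemma lin_addK (a b : K) : L.[a + b] = L.[a] + L.[b].
Proof. by have := lin_add hL (idfun : {rmorphism K -> K}) a b; rewrite map_poly_id. Qed.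

Lemma lin0 : L.[0] = 0.
Proof. by apply: (addrI L.[0]); rewrite -lin_addK !addr0. Qed.

Lemma lin_factor : exists2 M : {poly K}, L = M * 'X & M.[0] != 0.
Proof.
have /factor_theorem [M ME] : root L 0 by rewrite rootE lin0.
rewrite subr0 in ME; exists M => //.
by have := lin_coef1 hL; rewrite ME coefMX /= horner_coef0.
Qed.

Lemma linN a : L.[- a] = - L.[a].
Proof. by apply/eqP; rewrite -addr_eq0 -lin_addK addNr lin0. Qed.

Lemma linBF (F : fieldType) (f : {rmorphism K -> F}) (a b : F) :
   (map_poly f L).[a - b] = (map_poly f L).[a] - (map_poly f L).[b].
Proof. by apply: (addIr (map_poly f L).[b]); rewrite -lin_addF !subrK. Qed.

Lemma lin_sep : separable_poly L.
Proof.
rewrite separable_poly.unlock (lin_deriv hL) -alg_polyC coprimepZr ?coprimep1 //.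
exact: lin_coef1 hL.
Qed.

End LinPoly.

Lemma lin_roots (K : closedFieldType) (q : nat) (L : {poly K}) : lin_poly q L ->
  { r : seq K | [/\ uniq r, size r = q, forall b, (b \in r) = (L.[b] == 0)
               & L = lead_coef L *: \prod_(z <- r) ('X - z%:P)] }.
Proof.
move=> hL; have [r Lr] := closed_field_poly_normal L; exists r.
have lc0 : lead_coef L != 0 by rewrite lead_coef_eq0 (lin_neq0 hL).
split=> //.
- by have := lin_sep hL; rewrite Lr (eqp_separable (eqp_scale _ lc0)) separable_prod_XsubC.
- by have := lin_size hL; rewrite Lr size_scale // size_prod_XsubC => -[].
- by move=> b; rewrite {1}Lr hornerZ mulf_eq0 (negPf lc0) -rootE root_prod_XsubC.
Qed.

Section FunctionFieldBasics.
Variables (K : closedFieldType) (F : fieldType) (iota : {rmorphism K -> F}).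
Variables (q : nat) (L1 L2 : {poly K}) (x y : F).
Hypothesis hC : curve iota q L1 L2 x y.

Local Notation ev := (eval_XY iota).
Local Notation "P .@[ z ]" := (map_poly iota P).[z] (at level 2, format "P .@[ z ]").
Local Notation f := (curve_poly L1 L2).

Let hL1 := curve_lin1 hC.
Let hL2 := curve_lin2 hC.

Lemma curve_ker G : ev x y G = 0 <-> exists h, G = h * f.
Proof. by case: (curve_ff hC). Qed.

Lemma curve_frac z : exists G H, ev x y H != 0 /\ z = ev x y G / ev x y H.
Proof. by case: (curve_ff hC). Qed.

Lemma curve_poly_eval : ev x y f = 0.
Proof. by apply/curve_ker; exists 1; rewrite mul1r. Qed.

Lemma curve_eq : L1.@[x] * L2.@[y] = 1.
Proof.
by apply/eqP; rewrite -subr_eq0 -eval_curve curve_poly_eval.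
Qed.

Lemma curve_poly_size : size f = q.+1.
Proof.
have szL2 : size (map_poly polyC L2) = q.+1.
  by rewrite size_map_inj_poly ?(lin_size hL2) //; apply: polyC_inj.
have szL : size (L1%:P * map_poly polyC L2) = q.+1.
  by rewrite mul_polyC size_scale // (lin_neq0 hL1).
rewrite /curve_poly size_polyDl ?szL // size_polyN size_poly1.
by rewrite ltnS; apply: ltn_trans (curve_q hC).
Qed.

Lemma curve_poly_neq0 : f != 0.
Proof. by rewrite -size_poly_eq0 curve_poly_size. Qed.

Lemma curve_ind (S : F -> Prop) :
    (forall c, S (iota c)) -> S x -> S y ->
    (forall a b, S a -> S b -> S (a + b)) ->
    (forall a b, S a -> S b -> S (a * b)) ->
    (forall a, S a -> S a^-1) ->
  forall z, S z.
Proof.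
move=> SK Sx Sy SD SM SV z; have [G [H [_ ->]]] := curve_frac z.
by apply: (SM); [|apply: SV]; apply: eval_closed.
Qed.

(** The equation has degree [q > 0] in [Y], so none of its nonzero multiples is constant in [Y]. *)
Lemma curve_transc A : A.@[x] = 0 -> A = 0.
Proof.
rewrite -(evalC iota x y) => /curve_ker [h Ah].
have [h0|h0] := eqVneq h 0.
  by apply/eqP; rewrite -polyC_eq0 Ah h0 mul0r.
have := congr1 (fun p : {poly {poly K}} => size p) Ah.
rewrite /= size_mul ?curve_poly_neq0 // curve_poly_size addnS /= => szA.
have := size_polyC_leq1 A; rewrite szA => le1.
have : (q < 1)%N.
  apply: leq_trans le1; rewrite -addn1 addnC leq_add2r size_poly_gt0 //.
by have := curve_q hC; case: (q) => // ? ? .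
Qed.

Lemma evalZ c G : ev x y (c *: G) = c.@[x] * ev x y G.
Proof. by rewrite -mul_polyC evalM evalC. Qed.

(** The resultant in [Y] of [G] and the equation serves as a norm to K[x]: it is a combination of
    the two, so it evaluates to a multiple of the value of [G]. *)
Lemma curve_norm G : ev x y G != 0 ->
  exists U A, A != 0 /\ ev x y G * ev x y U = A.@[x].
Proof.
move=> evG0.
have G0 : G != 0 by apply: contraNneq evG0 => ->; rewrite eval0.
have [sG|sG] := leqP (size G) 1.
  have Gc := size1_polyC sG; exists 1, G`_0; rewrite eval1 mulr1 {2}Gc evalC.
  by split=> //; apply: contraNneq G0 => G00; rewrite Gc G00.
have sf : (1 < size f)%N by rewrite curve_poly_size ltnS (leq_trans _ (curve_q hC)).
have [[U V] /= _ resE] := resultant_in_ideal sG sf.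
exists U, (resultant G f); split; last first.
  by rewrite -(evalC iota x y) resE evalD !evalM curve_poly_eval mulr0 addr0 mulrC.
(* Nonvanishing amounts to a gcd [d] of degree 0 in [Y]. Write [f = e' d] up to a factor in K[X].
   Either [e'] vanishes at [(x, y)], so it is a multiple of [f] and [d] has degree 0, or [d]
   vanishes there, and then so does [G]. *)
rewrite resultant_eq0 -leqNgt.
set d := Pdiv.Idomain.gcdp G f.
have /Pdiv.Idomain.dvdpP [[c e] /= c0 ce] : Pdiv.Idomain.dvdp d G.
  exact: Pdiv.Idomain.dvdp_gcdl.
have /Pdiv.Idomain.dvdpP [[c' e'] /= c'0 ce'] : Pdiv.Idomain.dvdp d f.
  exact: Pdiv.Idomain.dvdp_gcdr.
have : ev x y e' * ev x y d = 0.
  by rewrite -evalM -ce'; apply/curve_ker; exists c'%:P; rewrite mul_polyC.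
move/eqP; rewrite mulf_eq0 => /orP[] /eqP.
  move/curve_ker => [h e'h]; move: ce'; rewrite e'h mulrAC -mul_polyC.
  move/(mulIf curve_poly_neq0) => ch.
  have : size (h * d) = 1%N by rewrite -ch size_polyC c'0.
  have [h0 d0] : h != 0 /\ d != 0.
    by split; apply: contraNneq c'0 => z; rewrite -polyC_eq0 ch z ?mul0r ?mulr0.
  rewrite size_mul // => szhd.
  move: h0 szhd; rewrite -size_poly_gt0; case: (size h) => // n _.
  by rewrite addSn /= => <-; rewrite leq_addl.
move=> evd; have := congr1 (ev x y) ce.
rewrite evalM evd mulr0 evalZ => /eqP; rewrite mulf_eq0 (negPf evG0) orbF.
by move/eqP/curve_transc/eqP; rewrite (negPf c0).
Qed.

(** [curve_norm] removes [y] from the denominator; pseudo-division by the equation then lowers the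
    degree in [y], and the powers of the leading coefficient that it costs join the denominator. *)
Lemma curve_rep z : exists (P : {poly {poly K}}) (A : {poly K}),
  [/\ (size P <= q)%N, A != 0 & z = ev x y P / A.@[x]].
Proof.
have [G [H [H0 ->]]] := curve_frac z.
have [U [A [A0 HU]]] := curve_norm H0.
have Ax0 : A.@[x] != 0 by apply: contraNneq A0 => /curve_transc ->.
have U0 : ev x y U != 0 by apply: contraNneq Ax0 => U0; rewrite -HU U0 mulr0.
have := Pdiv.Idomain.divp_eq (G * U) f.
set P := Pdiv.Idomain.modp (G * U) f; set n := Pdiv.Idomain.scalp _ _ => def.
have lx0 : (lead_coef f ^+ n).@[x] != 0.
  apply/eqP=> /curve_transc /eqP; rewrite expf_eq0 lead_coef_eq0.
  by rewrite (negPf curve_poly_neq0) andbF.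
exists P, (A * lead_coef f ^+ n); split.
- by rewrite -ltnS -curve_poly_size Pdiv.Idomain.ltn_modp curve_poly_neq0.
- by rewrite mulf_neq0 // expf_neq0 // lead_coef_eq0 curve_poly_neq0.
have := congr1 (ev x y) def; rewrite evalZ evalD !evalM curve_poly_eval mulr0 add0r => <-.
rewrite rmorphM hornerM -HU; field.
by rewrite lx0 U0 H0.
Qed.

End FunctionFieldBasics.

(** Lagrange interpolation at the nodes [z + b], read in top degree. The derivative of the node
    polynomial is the constant [d], so all Lagrange denominators are equal and the sum needs no
    weights. *)
Lemma lagrange_sum (K F : fieldType) (iota : {rmorphism K -> F})
    (r : seq K) (d : K) (z : F) (P : {poly F}) :
    uniq r -> (\prod_(c <- r) ('X - c%:P))^`() = d%:P ->
    (size P <= size r)%N ->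
  \sum_(b <- r) P.[z + iota b] = iota d * P`_(size r).-1.
Proof.
move=> ur hd sP.
pose node b := z + iota b.
pose Q b : {poly F} := \prod_(c <- r | c != b) ('X - (node c)%:P).
have Qmonic b : Q b \is monic by apply: monic_prod => c _; apply: monicXsubC.
have szQ b : b \in r -> size (Q b) = size r.
  move=> br; rewrite /Q -big_filter.
  rewrite -(big_map node xpredT (fun w => 'X - w%:P)) size_prod_XsubC size_map.
  rewrite -(rem_filter b ur) size_rem // prednK //.
  by case: (r) br.
have Qnode b : b \in r -> (Q b).[node b] = iota d.
  move=> br; have := congr1 (horner^~ b) hd; rewrite hornerC => <-.
  rewrite (bigD1_seq b) //= derivM derivXsubC mul1r hornerD hornerM.
  rewrite hornerXsubC subrr mul0r addr0 !horner_prod rmorph_prod.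
  by apply: eq_bigr => c _; rewrite !hornerXsubC rmorphB /node; ring.
have Qnode0 b c : b \in r -> b != c -> (Q c).[node b] = 0.
  move=> br bc; rewrite /Q horner_prod -big_filter (bigD1_seq b) ?mem_filter ?bc ?filter_uniq //=.
  by rewrite hornerXsubC subrr mul0r.
(* The interpolation identity multiplied by [d]: [R] has degree below the number of nodes and
   vanishes at each of them. *)
pose R := \sum_(b <- r) P.[node b] *: Q b - iota d *: P.
have R0 : R = 0.
  apply: (@roots_geq_poly_eq0 _ R (map node r)).
  - apply/allP => _ /mapP [b br ->]; rewrite rootE /R hornerD hornerN hornerZ.
    rewrite horner_sum (bigD1_seq b) //= hornerZ Qnode // big_seq_cond big1.
      by rewrite addr0 mulrC subrr.
    by move=> c /andP [cr cb]; rewrite hornerZ Qnode0 ?mulr0 // eq_sym.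
  - by rewrite map_inj_uniq // => b c /addrI /fmorph_inj.
  rewrite size_map /R (leq_trans (size_polyD _ _)) // geq_max size_polyN.
  rewrite (leq_trans (size_scale_leq _ _)) // andbT.
  rewrite big_seq (leq_trans (size_sum _ _ _)) //.
  apply/bigmax_leqP_seq => b br _; rewrite (leq_trans (size_scale_leq _ _)) //.
  by rewrite szQ.
have /eqP := congr1 (fun p : {poly F} => p`_(size r).-1) R0.
rewrite coef0 coefB coefZ coef_sum subr_eq0 => /eqP <-.
rewrite !big_seq; apply: eq_bigr => b br; rewrite coefZ.
by have := Qmonic b; rewrite monicE lead_coefE szQ // => /eqP ->; rewrite mulr1.
Qed.

(** * Morphisms and translations of the function field *)

Section EvaluationMorphisms.
Variables (K F : fieldType) (iota : {rmorphism K -> F}).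
Local Notation ev := (eval_XY iota).
Local Notation "P .@[ z ]" := (map_poly iota P).[z] (at level 2, format "P .@[ z ]").

Lemma eval_as_horner u v G :
  ev u v G = (map_poly (horner_eval u \o map_poly iota) G).[v].
Proof.
elim/poly_ind: G => [|G c IH]; first by rewrite rmorph0 horner0 eval0.
rewrite evalD evalM evalC evalY IH rmorphD rmorphM /= map_polyX map_polyC.
by rewrite hornerMXaddC.
Qed.

Lemma rmorph_eval (s : {rmorphism F -> F}) u v G :
  (forall c, s (iota c) = iota c) -> s (ev u v G) = ev (s u) (s v) G.
Proof.
move=> sK; elim/poly_ind: G => [|G c IH]; first by rewrite !eval0 rmorph0.
rewrite !evalD !evalM !evalC !evalY rmorphD rmorphM IH -horner_map -map_poly_comp.
by congr (_ + _.[_]); apply: eq_map_poly => k /=; rewrite sK.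
Qed.

Lemma rmorph_horner (s : {rmorphism F -> F}) u (A : {poly K}) :
  (forall c, s (iota c) = iota c) -> s (A.@[u]) = A.@[s u].
Proof.
move=> sK; rewrite -horner_map -map_poly_comp.
by congr (_.[_]); apply: eq_map_poly => k /=; rewrite sK.
Qed.

Lemma horner_iota (A : {poly K}) c : A.@[iota c] = iota A.[c].
Proof. by rewrite horner_map. Qed.

Definition affine_sub (a b c d : K) (G : {poly {poly K}}) :=
  (map_poly (fun A => A \Po (a *: 'X + b%:P)) G) \Po (c%:P *: 'X + d%:P%:P).

Lemma eval_affine a b c d u v G :
  ev u v (affine_sub a b c d G) = ev (iota a * u + iota b) (iota c * v + iota d) G.
Proof.
rewrite /affine_sub; elim/poly_ind: G => [|G k IH].
  by rewrite rmorph0 comp_poly0 !eval0.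
rewrite !evalD !evalM evalC evalY rmorphD rmorphM /= map_polyX map_polyC /=.
rewrite comp_polyD comp_polyM comp_polyX comp_polyC evalD evalM IH.
congr (_ * _ + _).
  by rewrite evalD -mul_polyC evalM evalY !evalC !map_polyC !hornerC.
rewrite evalC map_comp_poly horner_comp; congr (_.[_]).
by rewrite rmorphD /= linearZ /= map_polyX map_polyC hornerD hornerZ hornerX hornerC.
Qed.

End EvaluationMorphisms.

Section FunctionFieldMorphisms.
Variables (K : closedFieldType) (F : fieldType) (iota : {rmorphism K -> F}).
Variables (q : nat) (L1 L2 : {poly K}) (x y : F).
Hypothesis hC : curve iota q L1 L2 x y.

Local Notation ev := (eval_XY iota).
Local Notation "P .@[ z ]" := (map_poly iota P).[z] (at level 2, format "P .@[ z ]").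

Let hL1 := curve_lin1 hC.
Let hL2 := curve_lin2 hC.

Lemma curve_ker_sol u v G : L1.@[u] * L2.@[v] = 1 -> ev x y G = 0 -> ev u v G = 0.
Proof.
by move=> uv /(curve_ker hC) [h ->]; rewrite evalM eval_curve uv subrr mulr0.
Qed.

(** A quotient of values at [(x, y)] is sent to the same quotient at [(u, v)]. The equation at
    [(u, v)] makes the result independent of the chosen quotient, and the second hypothesis keeps
    denominators nonzero. *)
Lemma curve_morph u v : L1.@[u] * L2.@[v] = 1 ->
    (forall H, ev u v H = 0 -> ev x y H = 0) ->
  {s : {rmorphism F -> F} |
    [/\ forall c, s (iota c) = iota c, s x = u & s y = v]}.
Proof.
move=> uv inj.
pose fracP z := fun GH : {poly {poly K}} * {poly {poly K}} =>
  (ev x y GH.2 != 0) && (z == ev x y GH.1 / ev x y GH.2).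
have ex z : exists GH, fracP z GH.
  have [G [H [H0 ->]]] := curve_frac hC z.
  by exists (G, H); rewrite /fracP /= H0 eqxx.
pose s z := ev u v (xchoose (ex z)).1 / ev u v (xchoose (ex z)).2.
have sE G H : ev x y H != 0 -> s (ev x y G / ev x y H) = ev u v G / ev u v H.
  move=> H0; rewrite /s; have := xchooseP (ex (ev x y G / ev x y H)).
  set GH := xchoose _ => /andP [GH0]; rewrite eqr_div // => /eqP e.
  have nz H' : ev x y H' != 0 -> ev u v H' != 0.
    by apply: contra_neq => /inj.
  apply/eqP; rewrite eqr_div ?nz //; apply/eqP.
  have : ev x y (G * GH.2 - GH.1 * H) = 0.
    by rewrite evalB !evalM e subrr.
  by move/(curve_ker_sol uv); rewrite evalB !evalM => /eqP; rewrite subr_eq0 => /eqP.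
have nz H' : ev x y H' != 0 -> ev u v H' != 0.
  by apply: contra_neq => /inj.
have s1E G : s (ev x y G) = ev u v G.
  by have := sE G 1; rewrite !eval1 !divr1; apply; apply: oner_neq0.
have sB : zmod_morphism s.
  move=> a b; have [G [H [H0 ->]]] := curve_frac hC a.
  have [G' [H' [H'0 ->]]] := curve_frac hC b.
  have -> : ev x y G / ev x y H - ev x y G' / ev x y H' =
     ev x y (G * H' - G' * H) / ev x y (H * H').
    by rewrite evalB !evalM; field; rewrite H0 H'0.
  rewrite !sE ?evalM ?mulf_neq0 // evalB !evalM. field.
  by rewrite !nz.
have sM : monoid_morphism s.
  split=> [|a b]; first by have := s1E 1; rewrite !eval1.
  have [G [H [H0 ->]]] := curve_frac hC a.
  have [G' [H' [H'0 ->]]] := curve_frac hC b.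
  rewrite mulf_div -!evalM !sE ?evalM ?mulf_neq0 //.
  by rewrite mulf_div.
pose sa := GRing.isZmodMorphism.Build F F s sB.
pose sm := GRing.isMonoidMorphism.Build F F s sM.
pose S : {rmorphism F -> F} := HB.pack s sa sm.
exists S; split=> [c||].
- by have := s1E c%:P%:P; rewrite !evalC map_polyC !hornerC.
- by have := s1E 'X%:P; rewrite !evalX.
- by have := s1E 'X; rewrite !evalY.
Qed.

Lemma curve_morph_eq (s t : {rmorphism F -> F}) :
    (forall c, s (iota c) = iota c) -> (forall c, t (iota c) = iota c) ->
  s x = t x -> s y = t y -> s =1 t.
Proof.
move=> sK tK sx sy; apply: (curve_ind hC) => //.
- by move=> c; rewrite sK tK.
- by move=> a b sa sb; rewrite !rmorphD sa sb.
- by move=> a b sa sb; rewrite !rmorphM sa sb.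
- by move=> a sa; rewrite !fmorphV sa.
Qed.

Definition is_translation (b : K) (t : {rmorphism F -> F}) :=
  [/\ forall c, t (iota c) = iota c, t x = x & t y = y + iota b].

Lemma curve_affine_morph a b c d : a != 0 -> c != 0 ->
    (forall u v, L1.@[u] * L2.@[v] = 1 <->
       L1.@[iota a * u + iota b] * L2.@[iota c * v + iota d] = 1) ->
  {s : {rmorphism F -> F} |
    [/\ forall k, s (iota k) = iota k, s x = iota a * x + iota b
      & s y = iota c * y + iota d]}.
Proof.
move=> a0 c0 sol; apply: curve_morph; first by rewrite -sol (curve_eq hC).
have a0' : iota a != 0 by rewrite fmorph_eq0.
have c0' : iota c != 0 by rewrite fmorph_eq0.
have xE : iota a * (iota a^-1 * x - iota (a^-1 * b)) + iota b = x.
  by rewrite rmorphM fmorphV; field.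
have yE : iota c * (iota c^-1 * y - iota (c^-1 * d)) + iota d = y.
  by rewrite rmorphM fmorphV; field.
(* [(u, v)] is the preimage of [(x, y)] under the affine map and lies on the curve. A relation at
   [(x, y)] for the substituted polynomial thus holds at [(u, v)], where that polynomial takes the
   value of [H] at [(x, y)]. *)
move=> H; rewrite -eval_affine.
set u := _ * x - _ in xE; set v := _ * y - _ in yE.
move=> /(@curve_ker_sol u v); rewrite eval_affine xE yE; apply.
by rewrite sol xE yE (curve_eq hC).
Qed.

Lemma curve_translation b : L2.[b] = 0 -> {t | is_translation b t}.
Proof.
move=> Lb.
have [u v|t [tK tx ty]] := @curve_affine_morph 1 0 1 b (oner_neq0 _) (oner_neq0 _).
  rewrite !rmorph1 rmorph0 !mul1r addr0 (lin_addF hL2) horner_iota Lb rmorph0 addr0.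
  by [].
by exists t; split=> //; rewrite ?tx ?ty !rmorph1 ?rmorph0 mul1r ?addr0.
Qed.

End FunctionFieldMorphisms.

(** * Derivations, translations and the trace to K(x) *)

Record derivation_over (K F : fieldType) (iota : {rmorphism K -> F}) (D : F -> F) : Prop :=
  DerivationOver {
    derD : forall a b, D (a + b) = D a + D b;
    derM : forall a b, D (a * b) = D a * b + a * D b;
    derK : forall c, D (iota c) = 0 }.

Section DerivationTheory.
Variables (K F : fieldType) (iota : {rmorphism K -> F}) (D : F -> F).
Hypothesis hD : derivation_over iota D.

Lemma der0 : D 0 = 0.
Proof. by have := derK hD 0; rewrite rmorph0. Qed.

Lemma derV a : a != 0 -> D a^-1 = - D a / a ^+ 2.
Proof.
move=> a0; have : D (a * a^-1) = 0 by have := derK hD 1; rewrite mulfV // rmorph1.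
rewrite (derM hD) => /eqP; rewrite addrC addr_eq0 => /eqP e.
by apply: (mulfI a0); rewrite e; field.
Qed.

Lemma der_horner (A : {poly K}) z :
  D (map_poly iota A).[z] = (map_poly iota A^`()).[z] * D z.
Proof.
elim/poly_ind: A => [|A c IH]; first by rewrite deriv0 !rmorph0 !horner0 der0 mul0r.
rewrite derivMXaddC !rmorphD !rmorphM /= !map_polyX !map_polyC /=.
rewrite hornerMXaddC (derD hD) (derM hD) (derK hD) IH hornerD hornerM hornerX; ring.
Qed.

End DerivationTheory.

Section RationalFunctions.
Variables (K F : fieldType) (iota : {rmorphism K -> F}).
Local Notation "P .@[ z ]" := (map_poly iota P).[z] (at level 2, format "P .@[ z ]").

Definition transc (u : F) := forall A : {poly K}, A.@[u] = 0 -> A = 0.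

Definition in_Kx (x z : F) :=
  exists A B : {poly K}, B != 0 /\ z = A.@[x] / B.@[x].

Lemma in_Kx_coprime x z : transc x -> in_Kx x z ->
  exists A B : {poly K}, [/\ coprimep A B, B != 0 & z = A.@[x] / B.@[x]].
Proof.
move=> tx; case=> A [B [B0 ->]]; set g := gcdp A B.
have [gA gB] := (divpK (dvdp_gcdl A B), divpK (dvdp_gcdr A B)).
have g0 : g != 0 by rewrite gcdp_eq0 negb_and B0 orbT.
have nz C : C != 0 -> C.@[x] != 0.
  by apply: contra_neq => /tx.
have B'0 : B %/ g != 0 by apply: contraNneq B0 => e; rewrite -gB e mul0r.
exists (A %/ g), (B %/ g); split=> //; first by rewrite coprimep_div_gcd // B0 orbT.
have -> : A.@[x] = (A %/ g).@[x] * g.@[x] by rewrite -hornerM -rmorphM gA.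
have -> : B.@[x] = (B %/ g).@[x] * g.@[x] by rewrite -hornerM -rmorphM gB.
by field; rewrite !nz.
Qed.

End RationalFunctions.

Section TraceAndDerivation.
Variables (K : closedFieldType) (F : fieldType) (iota : {rmorphism K -> F}).
Variables (q : nat) (L1 L2 : {poly K}) (x y : F).
Hypothesis hC : curve iota q L1 L2 x y.

Local Notation ev := (eval_XY iota).
Local Notation "P .@[ z ]" := (map_poly iota P).[z] (at level 2, format "P .@[ z ]").
Local Notation f := (curve_poly L1 L2).

Let hL1 := curve_lin1 hC.
Let hL2 := curve_lin2 hC.

Definition roots2 : seq K := sval (lin_roots hL2).

Lemma roots2_uniq : uniq roots2.
Proof. by rewrite /roots2; case: lin_roots => r []. Qed.

Lemma roots2_size : size roots2 = q.
Proof. by rewrite /roots2; case: lin_roots => r []. Qed.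

Lemma mem_roots2 b : (b \in roots2) = (L2.[b] == 0).
Proof. by rewrite /roots2; case: lin_roots => r []. Qed.

(** The identity is a default value off the roots of [L2]; it makes [tau] total, so that sums over
    [roots2] carry no proofs. *)
Definition tau (b : K) : {rmorphism F -> F} :=
  match L2.[b] =P 0 with
  | ReflectT h => sval (curve_translation hC h)
  | ReflectF _ => idfun : {rmorphism F -> F}
  end.

Lemma tauP b : b \in roots2 -> is_translation iota x y b (tau b).
Proof.
rewrite mem_roots2 /tau => h; case: eqP => [h'|/eqP]; last by rewrite h.
by case: curve_translation.
Qed.

Definition trace (z : F) : F := \sum_(b <- roots2) tau b z.

Let d := L2`_1 / lead_coef L2.

Let d0 : iota d != 0.
Proof.
rewrite fmorph_eq0 mulf_neq0 ?(lin_coef1 hL2) // invr_eq0 lead_coef_eq0.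
exact: lin_neq0 hL2.
Qed.

Lemma roots2_deriv : (\prod_(c <- roots2) ('X - c%:P))^`() = d%:P.
Proof.
have := lin_deriv hL2; rewrite /roots2; case: lin_roots => r [_ _ _ /= {1}->].
rewrite derivZ => /(congr1 (fun p => (lead_coef L2)^-1 *: p)).
rewrite scalerA mulVf ?scale1r; last by rewrite lead_coef_eq0 (lin_neq0 hL2).
by move=> ->; rewrite -mul_polyC -polyCM mulrC.
Qed.

(** The conjugates of [y] are the nodes [y + b] of [lagrange_sum]; [d] is the derivative of the
    monic multiple of [L2]. The trace thus reads off the coefficient of [y^(q-1)]. *)
Lemma trace_rep (P : {poly {poly K}}) (A : {poly K}) : (size P <= q)%N ->
  trace (ev x y P / A.@[x]) = iota d * (P`_q.-1).@[x] / A.@[x].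
Proof.
move=> sP; rewrite /trace.
under eq_big_seq => b br.
  have [tK tx ty] := tauP br.
  rewrite rmorphM fmorphV (rmorph_eval _ _ _ tK) (rmorph_horner _ _ tK) tx ty.
  rewrite eval_as_horner.
  over.
rewrite -mulr_suml (lagrange_sum _ _ roots2_uniq roots2_deriv) roots2_size; last first.
  by rewrite (leq_trans (size_poly _ _)).
by rewrite coef_map.
Qed.

Local Notation in_Kx := (in_Kx iota x).

Lemma trace_in_Kx z : in_Kx (trace z).
Proof.
have [P [A [sP A0 ->]]] := curve_rep hC z.
rewrite trace_rep //; exists (d *: P`_q.-1), A; split=> //.
by rewrite linearZ /= hornerZ.
Qed.

Lemma traceD a b : trace (a + b) = trace a + trace b.
Proof. by rewrite /trace -big_split; apply: eq_bigr => c _; rewrite rmorphD. Qed.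

Lemma trace_yn n : (n < q.-1)%N -> trace (y ^+ n) = 0.
Proof.
move=> nq; have := @trace_rep 'X^n 1.
rewrite rmorph1 hornerC !divr1 evalXn evalY => ->.
  by rewrite coefXn gtn_eqF // rmorph0 horner0 mulr0.
by rewrite size_polyXn; apply: leq_trans nq (leq_pred _).
Qed.

Lemma traceZ c z : trace (iota c * z) = iota c * trace z.
Proof.
rewrite /trace mulr_sumr; apply: eq_big_seq => b /tauP [tK _ _].
by rewrite rmorphM tK.
Qed.

(** The trace of [z] itself is [q z = 0]. But [y^(q-1)] has trace [d], so the trace of [z y^(q-1)],
    an element of K(x), is [d z]. *)
Lemma trace_fixed z : (forall b, b \in roots2 -> tau b z = z) -> in_Kx z.
Proof.
move=> fz.
have try : trace (z * y ^+ q.-1) = z * iota d.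
  have -> : trace (z * y ^+ q.-1) = z * trace (y ^+ q.-1).
    rewrite /trace mulr_sumr; apply: eq_big_seq => b br.
    by rewrite rmorphM fz.
  congr (_ * _); have := @trace_rep 'X^(q.-1) 1.
  rewrite rmorph1 hornerC !divr1 evalXn evalY => ->.
    by rewrite coefXn eqxx rmorph1 hornerC mulr1.
  by rewrite size_polyXn prednK //; apply: leq_trans (curve_q hC).
have [A [B [B0 e]]] := trace_in_Kx (z * y ^+ q.-1).
exists (d^-1 *: A), B; split=> //; rewrite linearZ /= hornerZ fmorphV.
have Bx0 : B.@[x] != 0 by apply: contraNneq B0 => /(curve_transc hC) ->.
by apply: (mulIf d0); rewrite -try e; field; rewrite Bx0 d0.
Qed.

Section TangentDerivation.
Variables (dx dy : F).
Hypothesis tangent : iota L1`_1 * L2.@[y] * dx + iota L2`_1 * L1.@[x] * dy = 0.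

(** The partial derivative in the inner variable; [deriv] differentiates in the outer one. *)
Definition dX (G : {poly {poly K}}) := swapXY (swapXY G)^`().

Lemma dX_D G H : dX (G + H) = dX G + dX H.
Proof. by rewrite /dX !rmorphD /= derivD rmorphD. Qed.

Lemma dX_M G H : dX (G * H) = dX G * H + G * dX H.
Proof.
by rewrite /dX !rmorphM /= derivM rmorphD !rmorphM /= !swapXYK.
Qed.

Let Dev G := dx * ev x y (dX G) + dy * ev x y G^`().

Let DevD G H : Dev (G + H) = Dev G + Dev H.
Proof. by rewrite /Dev dX_D derivD !evalD; ring. Qed.

Let DevM G H : Dev (G * H) = Dev G * ev x y H + ev x y G * Dev H.
Proof. by rewrite /Dev dX_M derivM !evalD !evalM; ring. Qed.

Let DevC c : Dev c%:P%:P = 0.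
Proof.
rewrite /Dev /dX swapXY_polyC map_polyC /= !derivC rmorph0 eval0 !mulr0.
by rewrite addr0.
Qed.

Let Dev1 : Dev 1 = 0.
Proof. by rewrite -(DevC 1) !polyC1. Qed.

Let DevX : Dev 'X%:P = dx.
Proof.
rewrite /Dev /dX swapXY_polyC map_polyX derivX derivC rmorph1 eval0 eval1.
by rewrite mulr0 addr0 mulr1.
Qed.

Let DevY : Dev 'X = dy.
Proof.
rewrite /Dev /dX swapXY_X derivC rmorph0 derivX eval0 eval1.
by rewrite mulr0 add0r mulr1.
Qed.

Let Dev_polyC A : Dev A%:P = dx * A^`().@[x].
Proof.
rewrite /Dev /dX swapXY_polyC deriv_map swapXY_map_polyC derivC eval0 evalC.
by rewrite mulr0 addr0.
Qed.

Let Dev_map_polyC B : Dev (map_poly polyC B) = dy * B^`().@[y].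
Proof.
rewrite /Dev /dX swapXY_map_polyC derivC rmorph0 eval0 deriv_map eval_map_polyC.
by rewrite mulr0 add0r.
Qed.

Let Devf : Dev f = 0.
Proof.
have -> : f = L1%:P * map_poly polyC L2 + (-1)%:P%:P.
  by rewrite /curve_poly (polyCN (1 : K)) (polyCN (1 : {poly K})).
rewrite DevD DevM DevC addr0 Dev_polyC Dev_map_polyC evalC eval_map_polyC.
rewrite (lin_deriv hL1) (lin_deriv hL2) !map_polyC !hornerC -tangent; ring.
Qed.

Let Dev_ker G : ev x y G = 0 -> Dev G = 0.
Proof.
move/(curve_ker hC) => [h ->].
by rewrite DevM Devf (curve_poly_eval hC) !mulr0 addr0.
Qed.

(** [tangent] says that the derivative of the equation along [(dx, dy)] vanishes, so the derivative
    of a polynomial depends only on its class; the quotient rule extends it to fractions. *)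
Lemma curve_derivation : {D : F -> F | [/\ derivation_over iota D, D x = dx & D y = dy]}.
Proof.
pose fracP z := fun GH : {poly {poly K}} * {poly {poly K}} =>
  (ev x y GH.2 != 0) && (z == ev x y GH.1 / ev x y GH.2).
have ex z : exists GH, fracP z GH.
  have [G [H [H0 ->]]] := curve_frac hC z.
  by exists (G, H); rewrite /fracP /= H0 eqxx.
pose quot (G H : {poly {poly K}}) :=
  (Dev G * ev x y H - ev x y G * Dev H) / ev x y H ^+ 2.
pose D z := quot (xchoose (ex z)).1 (xchoose (ex z)).2.
have DE G H : ev x y H != 0 -> D (ev x y G / ev x y H) = quot G H.
  move=> H0; rewrite /D; have := xchooseP (ex (ev x y G / ev x y H)).
  set GH := xchoose _ => /andP [GH0]; rewrite eqr_div // => /eqP e.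
  have : ev x y (G * GH.2 - GH.1 * H) = 0 by rewrite evalB !evalM e subrr.
  move/Dev_ker; have -> : G * GH.2 - GH.1 * H = G * GH.2 + (-1)%:P%:P * (GH.1 * H).
    by rewrite (polyCN (1 : K)) (polyCN (1 : {poly K})) mulN1r.
  rewrite DevD !DevM DevC mul0r add0r evalC map_polyC hornerC /= rmorphN rmorph1 mulN1r => e'.
  apply/eqP; rewrite /quot eqr_div ?expf_neq0 // -subr_eq0; apply/eqP.
  have GE : ev x y G = ev x y GH.1 * ev x y H / ev x y GH.2 by rewrite -e mulfK.
  have DGE : Dev G = (- ev x y G * Dev GH.2 + Dev GH.1 * ev x y H
      + ev x y GH.1 * Dev H) / ev x y GH.2.
    apply: (canRL (mulfK GH0)); apply/eqP; rewrite -subr_eq0 -e'; apply/eqP; ring.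
  by rewrite DGE GE; field.
have D1 G : D (ev x y G) = Dev G.
  have := DE G 1; rewrite eval1 divr1 => -> //; last exact: oner_neq0.
  by rewrite /quot eval1 Dev1 mulr0 subr0 mulr1 expr1n divr1.
exists D; split; first split.
- move=> a b; have [G [H [H0 ->]]] := curve_frac hC a.
  have [G' [H' [H'0 ->]]] := curve_frac hC b.
  have -> : ev x y G / ev x y H + ev x y G' / ev x y H' =
     ev x y (G * H' + G' * H) / ev x y (H * H').
    by rewrite evalD !evalM; field; rewrite H0 H'0.
  rewrite !DE ?evalM ?mulf_neq0 // /quot DevD evalD !evalM !DevM; field.
  by rewrite H0 H'0.
- move=> a b; have [G [H [H0 ->]]] := curve_frac hC a.
  have [G' [H' [H'0 ->]]] := curve_frac hC b.
  rewrite mulf_div -!evalM !DE ?evalM ?mulf_neq0 // /quot !evalM !DevM; field.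
  by rewrite H0 H'0.
- by move=> c; have := D1 c%:P%:P; rewrite evalC map_polyC hornerC DevC.
- by have := D1 'X%:P; rewrite evalX DevX.
by have := D1 'X; rewrite evalY DevY.
Qed.

End TangentDerivation.

End TraceAndDerivation.

(** * Local rings and valuations *)

(** Expansion at infinity, with the coefficient of degree [n] set apart so that it can be recognized
    as the residue of a unit. *)
Lemma rev_poly (K F : fieldType) (iota : {rmorphism K -> F}) (n : nat) (L : {poly K}) :
    (size L <= n.+1)%N ->
  exists R : {poly K}, forall z : F, z != 0 ->
    (map_poly iota L).[z] = z ^+ n * (iota L`_n + z^-1 * (map_poly iota R).[z^-1]).
Proof.
elim: n L => [|n IH] L sL.
  exists 0 => z _; rewrite {1}(size1_polyC sL) map_polyC hornerC rmorph0 horner0.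
  by rewrite mulr0 addr0 mul1r.
have [|R hR] := IH (take_poly n.+1 L); first exact: size_take_poly.
exists (((take_poly n.+1 L)`_n)%:P + 'X * R) => z z0.
have LE : L = take_poly n.+1 L + L`_n.+1 *: 'X^(n.+1).
  rewrite -{1}[L](poly_take_drop n.+1); congr (_ + _).
  rewrite [drop_poly _ _]size1_polyC ?size_drop_poly ?leq_subLR ?addn1 //.
  by rewrite coef_drop_poly add0n mul_polyC.
rewrite {1}LE rmorphD /= linearZ /= hornerD hornerZ hR // map_polyXn hornerXn.
rewrite rmorphD rmorphM /= map_polyC map_polyX hornerD hornerM hornerX hornerC exprS.
by field.
Qed.

Record is_subring (K F : fieldType) (iota : {rmorphism K -> F}) (O : F -> Prop) : Prop :=
  IsSubring {
    subring_const : forall c, O (iota c);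
    subring_add : forall a b, O a -> O b -> O (a + b);
    subring_mul : forall a b, O a -> O b -> O (a * b) }.

Section Subring.
Variables (K F : fieldType) (iota : {rmorphism K -> F}) (O : F -> Prop).
Hypothesis hO : is_subring iota O.
Local Notation "P .@[ z ]" := (map_poly iota P).[z] (at level 2, format "P .@[ z ]").

Lemma subring0 : O 0. Proof. by rewrite -(rmorph0 iota); apply: subring_const hO _. Qed.
Lemma subring1 : O 1. Proof. by rewrite -(rmorph1 iota); apply: subring_const hO _. Qed.
Lemma subringN a : O a -> O (- a).
Proof.
move=> Oa; rewrite -mulN1r -(rmorphN1 iota).
by apply: (subring_mul hO) => //; apply: subring_const hO _.
Qed.
Lemma subringB a b : O a -> O b -> O (a - b).
Proof. by move=> Oa Ob; apply: (subring_add hO) => //; apply: subringN. Qed.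
Lemma subringX a n : O a -> O (a ^+ n).
Proof.
by move=> Oa; elim: n => [|n IH]; [apply: subring1 | rewrite exprS; apply: (subring_mul hO)].
Qed.
Lemma subring_horner (A : {poly K}) z : O z -> O A.@[z].
Proof.
move=> Oz; elim/poly_ind: A => [|A c IH]; first by rewrite rmorph0 horner0; apply: subring0.
rewrite rmorphD rmorphM /= map_polyX map_polyC hornerMXaddC.
by apply: (subring_add hO); [apply: (subring_mul hO) | apply: (subring_const hO)].
Qed.
Lemma subring_eval u v G : O u -> O v -> O (eval_XY iota u v G).
Proof.
by move=> Ou Ov; apply: eval_closed => //;
  [apply: subring_const hO | apply: subring_add hO | apply: subring_mul hO].
Qed.
Lemma subring_sum (I : eqType) (r : seq I) (E : I -> F) :
  (forall i, i \in r -> O (E i)) -> O (\sum_(i <- r) E i).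
Proof.
move=> OE; rewrite big_seq; apply: (big_ind O) => //; first exact: subring0.
exact: subring_add hO.
Qed.

Lemma subring_eval_cong (c1 c2 : K) t o1 o2 u1 u2 G : O t -> O o1 -> O o2 ->
    u1 = iota c1 + t * o1 -> u2 = iota c2 + t * o2 ->
  exists2 o, O o & eval_XY iota u1 u2 G =
    iota (eval_XY (idfun : {rmorphism K -> K}) c1 c2 G) + t * o.
Proof.
move=> Ot Oo1 Oo2 u1E u2E.
have Ou2 : O u2.
  by rewrite u2E; apply: (subring_add hO); [apply: subring_const hO _ | apply: (subring_mul hO)].
have Ou1 : O u1.
  by rewrite u1E; apply: (subring_add hO); [apply: subring_const hO _ | apply: (subring_mul hO)].
elim/poly_ind: G => [|G c [o Oo IH]].
  by exists 0; rewrite ?eval0 ?rmorph0 ?mulr0 ?addr0 //; apply: subring0.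
have [o' Oo' IHc] : exists2 o', O o' & c.@[u1] = iota c.[c1] + t * o'.
  elim/poly_ind: c => [|c k [o' Oo' IHc]].
    by exists 0; rewrite ?rmorph0 ?horner0 ?rmorph0 ?mulr0 ?addr0 //; apply: subring0.
  rewrite rmorphD rmorphM /= map_polyX map_polyC /= !hornerMXaddC IHc.
  exists (iota c.[c1] * o1 + o' * u1); last first.
    by rewrite rmorphD rmorphM u1E; ring.
  apply: (subring_add hO); apply: (subring_mul hO) => //; exact: subring_const hO _.
rewrite !evalD !evalM !evalY !evalC IH IHc map_poly_id //.
set g := eval_XY _ _ _ _.
exists (iota g * o2 + o * u2 + o'); last by rewrite rmorphD rmorphM /= u2E; ring.
by do ![apply: (subring_add hO)|apply: (subring_mul hO)] => //; apply: subring_const hO _.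
Qed.

End Subring.

(** A local ring with residue field [K] and maximal ideal generated by [t]. That it is a valuation
    ring of [F] requires in addition [val_separated]. *)
Record local_ring (K F : fieldType) (iota : {rmorphism K -> F}) (O : F -> Prop)
    (t : F) : Prop := LocalRing {
  loc_sub : is_subring iota O;
  loc_t : O t;
  loc_tV : ~ O t^-1;
  loc_unit : forall z, O z -> O z^-1 \/ (exists2 o, O o & z = t * o);
  loc_res : forall z, O z -> exists c, exists2 o, O o & z = iota c + t * o }.

Section PointRing.
Variables (K F : fieldType) (iota : {rmorphism K -> F}).
Variables (u1 u2 : F) (c1 c2 : K) (T : {poly {poly K}}).
Local Notation ev := (eval_XY iota u1 u2).
Local Notation evc := (eval_XY (idfun : {rmorphism K -> K}) c1 c2).

(* The local ring of the point [(c1, c2)] in the chart with coordinates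
   [(u1, u2)]; [ev T] below is a uniformizer. *)
Definition point_ring (z : F) :=
  exists G H, evc H != 0 /\ z = ev G / ev H.

Hypothesis hker : forall G, ev G = 0 -> evc G = 0.
Hypothesis hT : evc T = 0.
Hypothesis ht : ev T != 0.
Hypothesis hu1 : exists2 o, point_ring o & u1 = iota c1 + ev T * o.
Hypothesis hu2 : exists2 o, point_ring o & u2 = iota c2 + ev T * o.

Let nz H : evc H != 0 -> ev H != 0.
Proof. by apply: contra_neq => /hker. Qed.

Lemma point_ring_eval G : point_ring (ev G).
Proof. by exists G, 1; rewrite !eval1 divr1 oner_neq0. Qed.

Lemma point_ring_sub : is_subring iota point_ring.
Proof.
split.
- by move=> c; have := point_ring_eval c%:P%:P; rewrite evalC map_polyC hornerC.
- move=> _ _ [G [H [H0 ->]]] [G' [H' [H'0 ->]]].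
  exists (G * H' + G' * H), (H * H'); rewrite evalM mulf_neq0 //; split=> //.
  by rewrite evalD !evalM; field; rewrite !nz.
- move=> _ _ [G [H [H0 ->]]] [G' [H' [H'0 ->]]].
  exists (G * G'), (H * H'); rewrite evalM mulf_neq0 //; split=> //.
  by rewrite !evalM mulf_div.
Qed.

(** [hker] makes the residue at [(c1, c2)] well defined, and [hu1], [hu2] express smoothness: both
    [u1 - c1] and [u2 - c2] are multiples of the uniformizer. *)
Lemma point_ring_local : local_ring iota point_ring (ev T).
Proof.
have hO := point_ring_sub.
have Ot := point_ring_eval T.
have cong G : exists2 o, point_ring o & ev G = iota (evc G) + ev T * o.
  by case: hu1 => o1 Oo1 e1; case: hu2 => o2 Oo2 e2; apply: (subring_eval_cong hO G Ot Oo1 Oo2).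
split=> //.
- move=> [G [H [H0 e]]].
  have : ev (H - T * G) = 0.
    rewrite evalB evalM; apply/eqP; rewrite subr_eq0; apply/eqP.
    by apply: (mulfI (invr_neq0 ht)); rewrite mulKf // e divfK // nz.
  by move/hker/eqP; rewrite evalB evalM hT mul0r subr0 (negPf H0).
- move=> _ [G [H [H0 ->]]].
  have [G0|G0] := eqVneq (evc G) 0; last by left; rewrite invf_div; exists H, G.
  right; have [o Oo ->] := cong G; rewrite G0 rmorph0 add0r.
  exists (o / ev H); last by rewrite mulrA.
  by apply: (subring_mul hO) => //; exists 1, H; rewrite eval1 div1r.
- move=> _ [G [H [H0 ->]]]; exists (evc G / evc H).
  have [o Oo e] := cong (G - (evc G / evc H)%:P%:P * H).
  exists (o / ev H).
    by apply: (subring_mul hO) => //; exists 1, H; rewrite eval1 div1r.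
  move: e; rewrite !evalB !evalM !evalC !map_polyC !hornerC /= divfK // subrr rmorph0 add0r.
  move=> e; apply: (mulIf (nz H0)); rewrite mulrDl mulrA !divfK ?nz // -e.
  by rewrite addrC subrK.
Qed.

Lemma point_ring_deriv (D : F -> F) e : derivation_over iota D ->
    (exists2 o, point_ring o & D u1 = e * o) ->
    (exists2 o, point_ring o & D u2 = e * o) ->
  forall z, point_ring z -> exists2 o, point_ring o & D z = e * o.
Proof.
move=> hD [o1 Oo1 e1] [o2 Oo2 e2].
have hO := point_ring_sub.
have Dev G : exists2 o, point_ring o & D (ev G) = e * o.
  have [Ou1 Ou2] : point_ring u1 /\ point_ring u2.
    by split; [have := point_ring_eval 'X%:P; rewrite evalX
              |have := point_ring_eval 'X; rewrite evalY].
  suff [] : point_ring (ev G) /\ exists2 o, point_ring o & D (ev G) = e * o by [].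
  apply: (eval_closed (S := fun w => point_ring w /\
    exists2 o, point_ring o & D w = e * o)).
  - move=> c; split; first exact: subring_const hO _.
    by exists 0; [apply: subring0 hO | rewrite (derK hD) mulr0].
  - by split=> //; exists o1.
  - by split=> //; exists o2.
  - move=> a b [Oa [oa Ooa ea]] [Ob [ob Oob eb]]; split; first exact: (subring_add hO).
    by exists (oa + ob); [apply: (subring_add hO) | rewrite (derD hD) ea eb mulrDr].
  - move=> a b [Oa [oa Ooa ea]] [Ob [ob Oob eb]]; split; first exact: (subring_mul hO).
    exists (oa * b + a * ob); last by rewrite (derM hD) ea eb; ring.
    by apply: (subring_add hO); apply: (subring_mul hO).
move=> _ [G [H [H0 ->]]].
have OV : point_ring (ev H)^-1 by exists 1, H; rewrite eval1 div1r.
have [oG OG eG] := Dev G; have [oH OH eH] := Dev H.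
have OevG := point_ring_eval G.
exists (oG / ev H - ev G * oH / ev H ^+ 2).
  rewrite -exprVn; apply: (subringB hO); first exact: (subring_mul hO).
  by apply: (subring_mul hO); [apply: (subring_mul hO) | apply: (subringX hO)].
rewrite (derM hD) (derV hD) ?nz // eG eH; field; exact: nz.
Qed.

End PointRing.

Section Valuation.
Variables (K F : fieldType) (iota : {rmorphism K -> F}) (O : F -> Prop) (t : F).
Hypothesis hO : local_ring iota O t.
Let hS := loc_sub hO.

Lemma loc_t_neq0 : t != 0.
Proof. by apply/eqP => t0; apply: (loc_tV hO); rewrite t0 invr0; apply: subring0 hS. Qed.

(** The ideals [t^n O] have zero intersection, as Krull's theorem would give for a Noetherian
    ring. *)
Definition val_separated :=
  forall z, z != 0 -> exists n, forall o, O o -> z <> t ^+ n * o.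

(** By separatedness the extraction of factors [t] stops, so each nonzero element of [O] is a power
    of [t] times a unit. For a fraction, compare the two exponents. *)
Lemma loc_valuation : val_separated ->
    (forall z, exists a b, [/\ O a, O b, b != 0 & z = a / b]) ->
  forall z, O z \/ O z^-1.
Proof.
move=> sep frac.
have t0 := loc_t_neq0.
have fact z : O z -> z != 0 ->
    exists k, exists e, [/\ O e, O e^-1 & z = t ^+ k * e].
  move=> Oz z0; have [n] := sep z z0.
  elim: n z Oz z0 => [|n IH] z Oz z0 hn; first by case: (hn z); rewrite ?mul1r.
  have [OV|[o Oo zE]] := loc_unit hO Oz; first by exists 0%N, z; rewrite mul1r.
  have o0 : o != 0 by apply: contraNneq z0; rewrite zE => ->; rewrite mulr0.
  have [|k [e [Oe OeV oE]]] := IH o Oo o0.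
    by move=> o' Oo' oE; apply: (hn _ Oo'); rewrite zE oE exprS mulrA.
  by exists k.+1, e; rewrite zE oE exprS mulrA.
move=> z; have [-> |z0] := eqVneq z 0; first by left; apply: subring0 hS.
have [a [b [Oa Ob b0 zE]]] := frac z.
have a0 : a != 0 by apply: contraNneq z0 => a0; rewrite zE a0 mul0r.
have [k [e [Oe OeV aE]]] := fact a Oa a0.
have [l [e' [Oe' OeV' bE]]] := fact b Ob b0.
have e0 : e != 0 by apply: contraNneq a0; rewrite aE => ->; rewrite mulr0.
have e'0 : e' != 0 by apply: contraNneq b0; rewrite bE => ->; rewrite mulr0.
have tk0 n : t ^+ n != 0 by rewrite expf_neq0.
have [lk|/ltnW kl] := leqP l k.
  left; have -> : z = t ^+ (k - l) * (e * e'^-1).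
    by rewrite zE aE bE -{1}(subnK lk) exprD; field; rewrite e'0 tk0.
  by do ![apply: (subring_mul hS)] => //; apply: (subringX hS); apply: loc_t hO.
right; have -> : z^-1 = t ^+ (l - k) * (e^-1 * e').
  by rewrite zE aE bE -{1}(subnK kl) exprD; field; rewrite ?tk0 ?e0 ?e'0.
by do ![apply: (subring_mul hS)] => //; apply: (subringX hS); apply: loc_t hO.
Qed.

End Valuation.

(** * Poles and differentials in a valuation ring *)

Section ValuationPoles.
Variables (K F : fieldType) (iota : {rmorphism K -> F}) (O : F -> Prop).
Hypothesis hS : is_subring iota O.
Hypothesis hV : forall z, O z \/ O z^-1.
Local Notation "P .@[ z ]" := (map_poly iota P).[z] (at level 2, format "P .@[ z ]").

(** If [w] is not a unit, [c + w r] has the nonzero residue [c]. The proof needs no maximal ideal: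
    it asks which of [s / w] and [w / s] lies in [O]. *)
Lemma val_unit c w r : c != 0 -> O w -> O r -> O w^-1 \/ O (iota c + w * r)^-1.
Proof.
move=> c0 Ow Or; set s := iota c + w * r.
have ic0 : iota c != 0 by rewrite fmorph_eq0.
have OcV : O (iota c)^-1 by rewrite -fmorphV; apply: subring_const hS _.
have [->|w0] := eqVneq w 0; first by left; rewrite invr0; apply: subring0 hS.
have [s0|s0] := eqVneq s 0; first by right; rewrite s0 invr0; apply: subring0 hS.
have [Osw|Ows] := hV (s / w).
  left; have -> : w^-1 = (s / w - r) * (iota c)^-1 by rewrite /s; field; rewrite ?w0 ?ic0.
  by apply: (subring_mul hS) => //; apply: (subringB hS).
right; have -> : s^-1 = (1 - (s / w)^-1 * r) * (iota c)^-1.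
  have -> : r = (s - iota c) / w by rewrite /s; field.
  by field; rewrite ?w0 ?s0 ?ic0.
apply: (subring_mul hS) => //; apply: (subringB hS); first exact: subring1 hS.
exact: (subring_mul hS).
Qed.

(** Pole orders are encoded by divisibility: [1 / L(z)] vanishes at least to the order of [z^-q].
    Units [z] are not excluded. *)
Definition pole (q : nat) (L : {poly K}) (z : F) :=
  [/\ z != 0, O z^-1 & exists2 w, O w & L.@[z]^-1 = z^-1 ^+ q * w].

Lemma val_pole q (L : {poly K}) z : size L = q.+1 -> O z \/ pole q L z.
Proof.
move=> sL; have [->|z0] := eqVneq z 0; first by left; apply: subring0 hS.
case: (hV z) => [|OzV]; first by left.
have [R hR] := rev_poly iota (eq_leq sL).
have lc0 : L`_q != 0.
  by have := lead_coef_eq0 L; rewrite lead_coefE sL /= -size_poly_eq0 sL => ->.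
have [] := val_unit lc0 OzV (subring_horner hS R OzV); first by rewrite invrK; left.
move=> OV; right; split=> //.
exists (iota L`_q + z^-1 * R.@[z^-1])^-1 => //.
by rewrite hR // invfM exprVn.
Qed.

Section Solution.
Variables (q : nat) (L1 L2 : {poly K}) (D : F -> F) (e : F).
Hypothesis q1 : (1 < q)%N.
Hypothesis hL1 : lin_poly q L1.
Hypothesis hL2 : lin_poly q L2.
Hypothesis hD : derivation_over iota D.
Hypothesis hDO : forall z, O z -> exists2 o, O o & D z = e * o.

Lemma val_sol u v : L1.@[u] * L2.@[v] = 1 ->
  [\/ O u /\ O v, pole q L1 u /\ O v | O u /\ pole q L2 v].
Proof.
move=> uv.
have [Ou|pu] := val_pole u (lin_size hL1); have [Ov|pv] := val_pole v (lin_size hL2).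
- by constructor 1.
- by constructor 3.
- by constructor 2.
(* The product of the two expansions is 1, which makes [u^-1] a unit; hence [u] is in [O] and the
   third alternative holds. *)
case: (pu) => u0 OuV [w Ow wE]; case: (pv) => v0 OvV [w' Ow' w'E].
constructor 3; split=> //.
have e1 : (u^-1 ^+ q * w) * (v^-1 ^+ q * w') = 1 by rewrite -wE -w'E -invfM uv invr1.
have -> : u = u^-1 ^+ q.-1 * w * (v^-1 ^+ q * w').
  rewrite -[LHS]mulr1 -e1 -{1}(prednK (ltnW q1)) exprS !mulrA mulfV //.
  by rewrite mul1r.
by do ![apply: (subring_mul hS)|apply: (subringX hS)].
Qed.

Lemma der_sol u v : L1.@[u] * L2.@[v] = 1 ->
  iota L1`_1 * D u * L2.@[v] = - (iota L2`_1 * D v * L1.@[u]).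
Proof.
move=> uv; have : D (L1.@[u] * L2.@[v]) = 0.
  by rewrite uv -(rmorph1 iota) (derK hD).
rewrite (derM hD) !(der_horner hD) (lin_deriv hL1) (lin_deriv hL2).
rewrite !map_polyC !hornerC => /eqP; rewrite addr_eq0 => /eqP ->.
by congr (- _); ring.
Qed.

(** Origin of the bound [q - 2]: at a pole of [u], the factor [L2(v) = 1 / L1(u)] supplies [u^-q],
    while [D u = - u^2 D(1/u)] consumes two powers of [u] and [u^a] consumes [a]. *)
Lemma val_differential_reg u v a b : L1.@[u] * L2.@[v] = 1 -> O v -> (a <= q - 2)%N ->
  exists2 o, O o & u ^+ a * v ^+ b * D u * L2.@[v] = e * o.
Proof.
move=> uv Ov aq.
have [L0 _] := mul_eq1_neq0 uv.
have Lv : L2.@[v] = L1.@[u]^-1 by apply: (mulfI L0); rewrite uv mulfV.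
have OL2 := subring_horner hS L2 Ov.
case: (val_pole u (lin_size hL1)) => [Ou|[u0 OuV [w Ow wE]]].
  have [o Oo ->] := hDO Ou; exists (u ^+ a * v ^+ b * o * L2.@[v]); last by ring.
  by do ![apply: (subring_mul hS)|apply: (subringX hS)].
have [o Oo oE] := hDO OuV.
exists (- (v ^+ b * o * u^-1 ^+ (q - 2 - a) * w)).
  by apply: (subringN hS); do ![apply: (subring_mul hS)|apply: (subringX hS)].
have Du : D u = - (e * o) * u ^+ 2.
  by rewrite -oE (derV hD u0); field.
rewrite Lv wE Du.
have -> : u^-1 ^+ q = u^-1 ^+ (q - 2 - a) * u ^- a * u ^- 2.
  by rewrite -!exprVn -!exprD; congr (_ ^+ _); lia.
have ua : u ^+ a != 0 by rewrite expf_neq0.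
by field; rewrite u0 ua.
Qed.

End Solution.

(* For [D] = [k L1(x) d/dx] this is [u^a v^b du / L1(u)] divided by
   [dx / L1(x)], up to a constant. *)
Lemma val_differential (q : nat) (L1 L2 : {poly K}) (D : F -> F) (e : F)
    (u v : F) (a b : nat) :
    (1 < q)%N -> lin_poly q L1 -> lin_poly q L2 -> derivation_over iota D ->
    (forall z, O z -> exists2 o, O o & D z = e * o) ->
    L1.@[u] * L2.@[v] = 1 -> (a <= q - 2)%N -> (b <= q - 2)%N ->
  exists2 o, O o & u ^+ a * v ^+ b * D u * L2.@[v] = e * o.
Proof.
move=> q1 hL1 hL2 hD hDO uv aq bq.
have vu : L2.@[v] * L1.@[u] = 1 by rewrite mulrC.
have main : O v -> exists2 o, O o & u ^+ a * v ^+ b * D u * L2.@[v] = e * o.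
  by move=> Ov; apply: (val_differential_reg q1 hL1 hD hDO).
case: (val_sol q1 hL1 hL2 uv) => [[_]||[Ou _]] //; first by case.
(* At a pole of [v] the roles are exchanged: by [der_sol], [D u L2(v)] is a constant multiple of
   [D v L1(u)]. *)
have [o Oo oE] := val_differential_reg q1 hL2 hD hDO a vu Ou bq.
exists (- iota (L2`_1 / L1`_1) * o).
  by apply: (subring_mul hS) => //; apply: (subringN hS); apply: subring_const hS _.
have a1 : iota L1`_1 != 0 by rewrite fmorph_eq0 (lin_coef1 hL1).
rewrite mulrCA -oE; apply: (mulfI a1).
have -> : iota L1`_1 * (u ^+ a * v ^+ b * D u * L2.@[v]) =
  u ^+ a * v ^+ b * (iota L1`_1 * D u * L2.@[v]) by ring.
by rewrite (der_sol hL1 hL2 hD uv) rmorphM fmorphV; field.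
Qed.

End ValuationPoles.

Lemma loc_unit_res (K F : fieldType) (iota : {rmorphism K -> F}) (O : F -> Prop) t c o :
  local_ring iota O t -> c != 0 -> O o -> O (iota c + t * o)^-1.
Proof.
move=> hO c0 Oo; have hS := loc_sub hO; have t0 := loc_t_neq0 hO.
have Oz : O (iota c + t * o).
  apply: (subring_add hS); first exact: subring_const hS _.
  by apply: (subring_mul hS) => //; apply: loc_t hO.
case: (loc_unit hO Oz) => // -[o' Oo' e]; case: (loc_tV hO).
have ic0 : iota c != 0 by rewrite fmorph_eq0.
have -> : t^-1 = (o' - o) * iota c^-1.
  have -> : o' = (iota c + t * o) / t by rewrite e mulrAC mulfV // mul1r.
  by rewrite fmorphV; field; rewrite ?t0 ?ic0.
by apply: (subring_mul hS); [apply: (subringB hS) | apply: subring_const hS _].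
Qed.

(** * Valuation rings at the affine points and at the poles of a coordinate *)

Section CurveCharts.
Variables (K : closedFieldType) (F : fieldType) (iota : {rmorphism K -> F}).
Variables (q : nat) (L1 L2 : {poly K}) (x y : F).
Hypothesis hC : curve iota q L1 L2 x y.

Local Notation ev := (eval_XY iota).
Local Notation evK := (eval_XY (idfun : {rmorphism K -> K})).
Local Notation "P .@[ z ]" := (map_poly iota P).[z] (at level 2, format "P .@[ z ]").
Local Notation f := (curve_poly L1 L2).

Let hL1 := curve_lin1 hC.
Let hL2 := curve_lin2 hC.

Lemma curve_x_sub a : x - iota a != 0.
Proof.
apply/eqP => e; have : ('X - a%:P).@[x] = 0.
  by rewrite rmorphB /= map_polyX map_polyC hornerXsubC.
by move/(curve_transc hC)/eqP; rewrite polyXsubC_eq0.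
Qed.

Section LocalValuation.
Variables (O : F -> Prop) (t : F).
Hypothesis hO : local_ring iota O t.
Hypothesis Ox : exists k, O (t ^+ k * x).
Hypothesis Oy : exists k, O (t ^+ k * y).
Hypothesis OxV : forall a, exists k, O (t ^+ k * (x - iota a)^-1).
Let hS := loc_sub hO.
Let t0 : t != 0 := loc_t_neq0 hO.

(** The ring O[1/t]. The hypotheses put in it [x], [y] and every [1 / (x - a)], hence the inverses
    of all polynomials in [x], as [K] is closed. *)
Let Ot z := exists k, O (t ^+ k * z).

Let Ot_sub : is_subring iota Ot.
Proof.
split.
- by move=> c; exists 0%N; rewrite mul1r; apply: subring_const hS _.
- move=> a b [k Ok] [l Ol]; exists (k + l)%N.
  have -> : t ^+ (k + l) * (a + b) = t ^+ l * (t ^+ k * a) + t ^+ k * (t ^+ l * b).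
    by rewrite exprD; ring.
  by apply: (subring_add hS); apply: (subring_mul hS) => //; apply: (subringX hS); apply: loc_t hO.
move=> a b [k Ok] [l Ol]; exists (k + l)%N.
have -> : t ^+ (k + l) * (a * b) = (t ^+ k * a) * (t ^+ l * b) by rewrite exprD; ring.
exact: (subring_mul hS).
Qed.

Let Ot_poly_inv (A : {poly K}) : Ot (A.@[x])^-1.
Proof.
have [r ->] := closed_field_poly_normal A.
rewrite linearZ /= hornerZ rmorph_prod horner_prod invfM.
apply: (subring_mul Ot_sub); first by rewrite -fmorphV; apply: subring_const Ot_sub _.
rewrite -prodfV; apply: (big_ind Ot); first exact: subring1 Ot_sub.
  exact: subring_mul Ot_sub.
by move=> a _; rewrite rmorphB /= map_polyX map_polyC hornerXsubC; apply: OxV.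
Qed.

(** By [curve_norm], [1 / z] is a polynomial in [x], [y] divided by one in [x], so it lies in some
    [t^-m O]. Divisibility of [z] by [t^(m+1)] would then put [1 / t] in [O]. *)
Lemma curve_val_separated : val_separated O t.
Proof.
move=> z z0; have [G [H [H0 zE]]] := curve_frac hC z.
have G0 : ev x y G != 0 by apply: contraNneq z0 => G0; rewrite zE G0 mul0r.
have [U [A [A0 AE]]] := curve_norm hC G0.
have Ax0 : A.@[x] != 0 by apply: contraNneq A0 => /(curve_transc hC) ->.
have [m Om] : Ot (ev x y H * ev x y U * (A.@[x])^-1).
  by apply: (subring_mul Ot_sub (subring_mul Ot_sub _ _) (Ot_poly_inv A)); apply: subring_eval.
exists m.+1 => o Oo zo; apply: (loc_tV hO).
have -> : t^-1 = o * (t ^+ m * (ev x y H * ev x y U * (A.@[x])^-1)).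
  have tm : t ^+ m != 0 by rewrite expf_neq0.
  have -> : o = z / t ^+ m.+1 by rewrite zo mulrAC mulfV ?mul1r // expf_neq0.
  rewrite -AE zE exprS; field.
  by move: Ax0; rewrite -AE mulf_eq0 negb_or => /andP [_ ->]; rewrite ?tm ?t0 ?G0 ?H0.
exact: (subring_mul hS).
Qed.

Lemma curve_valuation z : O z \/ O z^-1.
Proof.
apply: (loc_valuation hO); first exact: curve_val_separated.
move=> w; have [G [H [H0 ->]]] := curve_frac hC w.
have [k Ok] := subring_eval Ot_sub G Ox Oy; have [l Ol] := subring_eval Ot_sub H Ox Oy.
have tn n : t ^+ n != 0 by rewrite expf_neq0.
have Otn n : O (t ^+ n) by apply: (subringX hS); apply: loc_t hO.
exists (t ^+ l * (t ^+ k * ev x y G)), (t ^+ k * (t ^+ l * ev x y H)); split.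
- exact: (subring_mul hS).
- exact: (subring_mul hS).
- by rewrite !mulf_neq0.
by field; rewrite ?H0 ?tn.
Qed.

End LocalValuation.

Section Derivation.
Variables (D : F -> F) (k1 k2 : K).
Hypothesis hD : derivation_over iota D.
Hypothesis hDx : D x = iota k1 * L1.@[x].
Hypothesis hDy : D y = iota k2 * L2.@[y].

Lemma affine_chart a b : L1.[a] * L2.[b] = 1 ->
  exists O, [/\ local_ring iota O (x - iota a), forall z, O z \/ O z^-1
    & forall z, O z -> exists2 o, O o & D z = 1 * o].
Proof.
move=> ab.
pose T : {poly {poly K}} := 'X%:P - a%:P%:P.
have TE u v : ev u v T = u - iota a by rewrite evalB evalX evalC map_polyC hornerC.
have ker G : ev x y G = 0 -> evK a b G = 0.
  move/(curve_ker hC) => [h ->]; rewrite evalM eval_curve !map_poly_id // ab.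
  by rewrite subrr mulr0.
have hT : evK a b T = 0 by rewrite evalB evalX evalC map_poly_id // hornerC subrr.
have t0 : ev x y T != 0 by rewrite TE curve_x_sub.
have hS := point_ring_sub ker.
set O := point_ring _ _ _ _ _ in hS.
have Oev G : O (ev x y G) := point_ring_eval _ _ _ _ _ _.
have Ox : O x by have := Oev 'X%:P; rewrite evalX.
have Oy : O y by have := Oev 'X; rewrite evalY.
have [La0 _] := mul_eq1_neq0 ab.
have hx : exists2 o, O o & x = iota a + ev x y T * o.
  by exists 1; [apply: subring1 hS | rewrite TE mulr1 addrC subrK].
have hy : exists2 o, O o & y = iota b + ev x y T * o.
  have [M1 L1E M10] := lin_factor hL1.
  have [M2 L2E M20] := lin_factor hL2.
  (* By additivity, subtracting the equation at [(a, b)] from that at [(x, y)] gives [(y - b) M2(y -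
     b) = - (x - a) M1(x - a) / (L1(a) L1(x))]. As [M2(0)] is nonzero, [y - b] is a multiple of the
     uniformizer [x - a], with denominator [H]. *)
  pose H := (L1.[a] *: L1)%:P * map_poly polyC (M2 \Po ('X - b%:P)).
  have H0 : evK a b H != 0.
    rewrite evalM evalC eval_map_polyC !map_poly_id // hornerZ !mulf_neq0 //.
    by rewrite horner_comp hornerXsubC subrr.
  exists (ev x y (- (M1 \Po ('X - a%:P))%:P) / ev x y H).
    by exists (- (M1 \Po ('X - a%:P))%:P), H.
  have HE : ev x y H = iota L1.[a] * L1.@[x] * M2.@[y - iota b].
    rewrite evalM evalC eval_map_polyC linearZ hornerZ map_comp_poly horner_comp.
    by rewrite rmorphB /= map_polyX map_polyC hornerXsubC.
  have NE : ev x y (- (M1 \Po ('X - a%:P))%:P) = - M1.@[x - iota a].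
    rewrite -polyCN evalC rmorphN /= hornerN map_comp_poly horner_comp.
    by rewrite rmorphB /= map_polyX map_polyC hornerXsubC.
  have H0' : ev x y H != 0 by apply: contraNneq H0 => /ker ->.
  rewrite TE HE NE; move: H0'; rewrite HE => H0'.
  have M1E : M1.@[x - iota a] * (x - iota a) = L1.@[x] - iota L1.[a].
    by rewrite -(horner_iota iota) -(linBF hL1) L1E rmorphM /= map_polyX hornerMX.
  have M2E : M2.@[y - iota b] * (y - iota b) = L2.@[y] - iota L2.[b].
    by rewrite -(horner_iota iota) -(linBF hL2) L2E rmorphM /= map_polyX hornerMX.
  have := curve_eq hC; have := congr1 iota ab; rewrite rmorphM rmorph1.
  move: H0'; set A := M1.@[_] in M1E *; set B := M2.@[_] in M2E *.
  set l1 := L1.@[x] in M1E *; set l2 := L2.@[y] in M2E *.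
  rewrite !mulf_eq0 !negb_or => /andP [/andP [ia0 l10] B0] e1 e2.
  have [_ ib0] := mul_eq1_neq0 e1; have [_ l20] := mul_eq1_neq0 e2.
  have -> : iota b + (x - iota a) * (- A / (iota L1.[a] * l1 * B)) =
     iota b - (A * (x - iota a)) / (iota L1.[a] * l1 * B).
    by rewrite mulrA mulrN mulNr [_ * A]mulrC.
  rewrite M1E.
  have -> : iota L1.[a] = (iota L2.[b])^-1 by apply: (mulIf ib0); rewrite e1 mulVf.
  have -> : l1 = l2^-1 by apply: (mulIf l20); rewrite e2 mulVf.
  apply: (mulfI B0); have -> : B * y = l2 - iota L2.[b] + B * iota b by rewrite -M2E; ring.
  by field; rewrite ?ib0 ?l20 ?B0.
have hloc := point_ring_local ker hT t0 hx hy.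
exists O; split.
- by rewrite -(TE x y).
- move=> z; apply: (curve_valuation hloc); rewrite ?TE.
  + by exists 0%N; rewrite mul1r.
  + by exists 0%N; rewrite mul1r.
  move=> c; have [<-|ac] := eqVneq a c.
    exists 1%N; rewrite mulfV ?curve_x_sub //; exact: subring1 hS.
  exists 0%N; rewrite mul1r; exists 1, ('X%:P - c%:P%:P).
  rewrite evalB evalX evalC map_poly_id // hornerC subr_eq0 ac; split=> //.
  by rewrite eval1 evalB evalX evalC map_polyC hornerC div1r.
apply: (point_ring_deriv ker hD).
- exists (D x); last by rewrite mul1r.
  by rewrite hDx; apply: (subring_mul hS); [apply: subring_const hS _ | apply: subring_horner].
- exists (D y); last by rewrite mul1r.
  by rewrite hDy; apply: (subring_mul hS); [apply: subring_const hS _ | apply: subring_horner].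
Qed.

Lemma curve_y_neq0 : y != 0.
Proof.
have [_] := mul_eq1_neq0 (curve_eq hC); apply: contraNneq => ->.
by rewrite -(rmorph0 iota) horner_iota (lin0 hL2).
Qed.

(* [G(x, 1/y) = 0] makes the reversed polynomial [G'] a multiple [h f]; at
   [X = alpha] it becomes [- h], whose degree in [Y] is too small. *)
Lemma eval_pole_ker alpha G : L1.[alpha] = 0 -> ev x y^-1 G = 0 -> evK alpha 0 G = 0.
Proof.
move=> La G0; have y0 := curve_y_neq0.
pose n := size G.
pose G' : {poly {poly K}} := \sum_(i < n) (G`_i)%:P * 'X^(n - i).
have G'E : ev x y G' = y ^+ n * ev x y^-1 G.
  rewrite eval_as_horner /G' !rmorph_sum horner_sum.
  rewrite eval_as_horner horner_coef mulr_sumr.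
  have szG : (size (map_poly (horner_eval x \o map_poly iota) G) <= n)%N.
    exact: size_poly.
  rewrite (big_ord_widen _
    (fun i => y ^+ n * ((map_poly (horner_eval x \o map_poly iota) G)`_i * y^-1 ^+ i)) szG).
  rewrite [RHS]big_mkcond /=; apply: eq_bigr => i _.
  rewrite rmorphM /= map_polyC map_polyXn hornerM hornerC hornerXn /=.
  case: ifP => [_|/negbT]; last first.
    rewrite -leqNgt => si.
    have : (map_poly (horner_eval x \o map_poly iota) G)`_i = 0 by apply: nth_default.
    by rewrite coef_map /= => ->; rewrite mul0r.
  rewrite coef_map /= mulrCA; congr (_ * _).
  have yi : y ^+ i != 0 by rewrite expf_neq0.
  by apply: (mulIf yi); rewrite exprVn divfK // -exprD subnK // ltnW.
have [h hE] : exists h, G' = h * f by apply/(curve_ker hC); rewrite G'E G0 mulr0.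
have szG' : (size G' <= n.+1)%N.
  rewrite /G' (leq_trans (size_sum _ _ _)) //; apply/bigmax_leqP => i _.
  rewrite mul_polyC (leq_trans (size_scale_leq _ _)) // size_polyXn ltnS leq_subr //.
have szh : (size h <= n)%N.
  have [->|h0] := eqVneq h 0; first by rewrite size_poly0.
  move: szG'; rewrite hE size_mul ?(curve_poly_neq0 hC) // (curve_poly_size hC) addnS /=.
  move=> le; rewrite -(leq_add2r q) (leq_trans le) // -addn1 leq_add2l.
  exact: ltnW (ltnW (curve_q hC)).
have : (map_poly (horner_eval alpha) G')`_n = - (map_poly (horner_eval alpha) h)`_n.
  rewrite hE rmorphM /= [map_poly _ f](_ : _ = -1) ?mulrN1 ?coefN //.
  rewrite /curve_poly rmorphB rmorphM rmorph1 /= map_polyC /= /horner_eval La.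
  by rewrite mul0r sub0r.
have hn : h`_n = 0 by apply: nth_default.
rewrite !(coef_map (horner_eval alpha)) /= hn /horner_eval horner0 oppr0 => G'n.
rewrite eval_as_horner horner_coef0 coef_map /= map_poly_id // /horner_eval -[RHS]G'n.
congr (_.[_]); rewrite /G' coef_sum.
have [n0|n0] := posnP n.
  by rewrite n0 big_ord0 nth_default // -/n n0.
rewrite (bigD1 (Ordinal n0)) //= subn0 coefCM coefXn eqxx mulr1 big1 ?addr0 //.
move=> i i0; rewrite coefCM coefXn; have -> : (n == n - i)%N = false; last by rewrite mulr0.
have : (i : nat) != 0%N by apply: contra i0 => /eqP i0; apply/eqP/val_inj.
have := ltn_ord i; lia.
Qed.

(* The point [x = alpha], [y = infinity], with uniformizer [1 / y]. *)
Lemma pole_chart alpha : L1.[alpha] = 0 ->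
  exists O, [/\ local_ring iota O y^-1, forall z, O z \/ O z^-1,
      forall z, O z -> exists2 o, O o & D z = y ^+ (q - 2) * o,
      forall b (s : {rmorphism F -> F}), is_translation iota x y b s ->
        forall z, O z -> O (s z)
    & exists2 o, O o & x = iota alpha + y^-1 * o].
Proof.
move=> La; have y0 := curve_y_neq0.
have TE u v : ev u v 'X = v by rewrite evalY.
have ker G := eval_pole_ker La (G := G).
have hT : evK alpha 0 'X = 0 by rewrite evalY.
have t0 : ev x y^-1 'X != 0 by rewrite evalY invr_neq0.
have hS := point_ring_sub ker.
set O := point_ring _ _ _ _ _ in hS.
have Oev G : O (ev x y^-1 G) := point_ring_eval _ _ _ _ _ _.
have Ox : O x by have := Oev 'X%:P; rewrite evalX.
have Os : O y^-1 by have := Oev 'X; rewrite evalY.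
have OV H : evK alpha 0 H != 0 -> O (ev x y^-1 H)^-1.
  by move=> H0; exists 1, H; rewrite eval1 div1r.
have nz H : evK alpha 0 H != 0 -> ev x y^-1 H != 0 by apply: contra_neq => /ker.
have [R hR] := rev_poly iota (eq_leq (lin_size hL2)).
have lc0 := lin_lead hL2.
have [M1 L1E M10] := lin_factor hL1.
(* [N] is the unit [y^-q L2(y)]. The equation becomes [(x - alpha) M1(x - alpha) N = y^-q], so
   [x - alpha] is [y^-q] divided by the unit [H] below. *)
pose N : {poly {poly K}} := (L2`_q)%:P%:P + 'X * map_poly polyC R.
have NE : ev x y^-1 N = iota L2`_q + y^-1 * R.@[y^-1].
  by rewrite evalD evalM evalC evalY eval_map_polyC map_polyC hornerC.
have N0 : evK alpha 0 N != 0.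
  by rewrite evalD evalM evalC evalY mul0r addr0 map_poly_id // hornerC.
pose H := N * (M1 \Po ('X - alpha%:P))%:P.
have H0 : evK alpha 0 H != 0.
  rewrite evalM mulf_neq0 // evalC map_poly_id // horner_comp hornerXsubC subrr //.
have L2y : L2.@[y] = y ^+ q * ev x y^-1 N by rewrite NE hR.
have M1E : M1.@[x - iota alpha] * (x - iota alpha) = L1.@[x].
  have <- : L1.@[x - iota alpha] = L1.@[x].
    by rewrite (linBF hL1) horner_iota La rmorph0 subr0.
  by rewrite L1E rmorphM /= map_polyX hornerMX.
have HE : ev x y^-1 H = ev x y^-1 N * M1.@[x - iota alpha].
  rewrite evalM evalC map_comp_poly horner_comp.
  by rewrite rmorphB /= map_polyX map_polyC hornerXsubC.
have yn n : y ^+ n != 0 by rewrite expf_neq0.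
have xE : x - iota alpha = y^-1 ^+ q * (ev x y^-1 H)^-1.
  apply: (mulIf (nz _ H0)); rewrite divfK ?nz //.
  apply: (mulfI (yn q)); rewrite -exprMn mulfV // expr1n HE.
  have := curve_eq hC; rewrite -M1E L2y => <-; ring.
have q2 := curve_q hC.
have hx : exists2 o, O o & x = iota alpha + ev x y^-1 'X * o.
  exists (y^-1 ^+ q.-1 * (ev x y^-1 H)^-1).
    by apply: (subring_mul hS); [apply: (subringX hS) | apply: OV].
  by rewrite evalY mulrA -exprS prednK ?(ltnW (ltnW q2)) // -xE addrC subrK.
have hs : exists2 o, O o & y^-1 = iota 0 + ev x y^-1 'X * o.
  by exists 1; [apply: subring1 hS | rewrite evalY mulr1 rmorph0 add0r].
have hloc := point_ring_local ker hT t0 hx hs.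
rewrite -/O evalY in hloc.
have hval : forall z, O z \/ O z^-1.
  apply: (curve_valuation hloc).
  - by exists 0%N; rewrite mul1r.
  - by exists 1%N; rewrite mulVf //; apply: subring1 hS.
  move=> c; have [<-|ac] := eqVneq alpha c.
    by exists q; rewrite xE invfM invrK mulrA mulfV ?mul1r ?expf_neq0 ?invr_neq0 //.
  exists 0%N; rewrite mul1r; have := OV ('X%:P - c%:P%:P).
  rewrite !evalB !evalX !evalC map_poly_id // map_polyC !hornerC; apply.
  by rewrite subr_eq0.
exists O; split=> //; last by move: hx; rewrite evalY.
(* The exponent [q - 2] comes from the uniformizer: [D(1/y) = - k2 L2(y) / y^2 = - k2 N y^(q-2)].
   For [x] the bound is weaker than regularity. *)
- apply: (point_ring_deriv ker hD).
    exists (y^-1 ^+ (q - 2) * (iota k1 * L1.@[x])).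
      apply: (subring_mul hS); first exact: (subringX hS).
      by apply: (subring_mul hS); [apply: subring_const hS _ | apply: subring_horner].
    by rewrite hDx mulrA -exprMn mulfV // expr1n mul1r.
  exists (- iota k2 * ev x y^-1 N).
    by apply: (subring_mul hS) => //; apply: (subringN hS); apply: subring_const hS _.
  rewrite (derV hD y0) hDy L2y -{1}(subnK (ltnW q2)) exprD; field; exact: y0.
(* A translation of [y] fixes the point at infinity: [1 / (y + b)] is [1 / y] times the unit
   [1 / (1 + b / y)], so residues are unchanged. *)
move=> b s [sK sx sy] _ [G [H' [H'0 ->]]].
have Ow : O (1 + y^-1 * iota b)^-1.
  by rewrite -(rmorph1 iota); apply: (loc_unit_res hloc (oner_neq0 _)); apply: subring_const hS _.
have sE : s y^-1 = iota 0 + y^-1 * (1 + y^-1 * iota b)^-1.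
  by rewrite fmorphV sy rmorph0 add0r -invfM mulrDr mulr1 mulrA mulfV // mul1r.
have [o1 Oo1 xE1] := hx; rewrite evalY in xE1.
rewrite rmorphM fmorphV !(rmorph_eval _ _ _ sK) sx.
have [oG OoG ->] := subring_eval_cong hS G Os Oo1 Ow xE1 sE.
have [oH OoH ->] := subring_eval_cong hS H' Os Oo1 Ow xE1 sE.
apply: (subring_mul hS).
  by apply: (subring_add hS); [apply: subring_const hS _ | apply: (subring_mul hS)].
exact: (loc_unit_res hloc).
Qed.

End Derivation.

End CurveCharts.

Lemma subn2_addSS k m : (2 < k)%N -> (k <= m)%N -> (k - 2 + (m - k).+2 = m)%N.
Proof. lia. Qed.

(** * Traces of holomorphic differentials *)

Section TraceOfDifferentials.
Variables (K : closedFieldType) (F : fieldType) (iota : {rmorphism K -> F}).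
Variables (q : nat) (L1 L2 : {poly K}) (x y : F).
Hypothesis hC : curve iota q L1 L2 x y.

Local Notation "P .@[ z ]" := (map_poly iota P).[z] (at level 2, format "P .@[ z ]").

Let hL1 := curve_lin1 hC.
Let hL2 := curve_lin2 hC.
Let q2 := curve_q hC.
Let q1 : (1 < q)%N := ltnW q2.

Variables (D : F -> F) (k1 k2 : K).
Hypothesis hD : derivation_over iota D.
Hypothesis hDx : D x = iota k1 * L1.@[x].
Hypothesis hDy : D y = iota k2 * L2.@[y].

(** A translation by a root of [L2] fixes both [L1(x)] and [L2(y)], so it commutes with [D] on the
    generators. *)
Lemma tau_der b z : b \in roots2 hC -> tau hC b (D z) = D (tau hC b z).
Proof.
move=> br; have [tK tx ty] := tauP br; move: z; apply: (curve_ind hC).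
- by move=> c; rewrite tK (derK hD) rmorph0.
- by rewrite tx hDx rmorphM tK (rmorph_horner _ _ tK) tx.
- rewrite ty (derD hD) (derK hD) addr0 hDy rmorphM tK (rmorph_horner _ _ tK) ty.
  rewrite (lin_addF hL2) horner_iota.
  by move: br; rewrite mem_roots2 => /eqP ->; rewrite rmorph0 addr0.
- by move=> a c ea ec; rewrite !rmorphD (derD hD) rmorphD ea ec (derD hD).
- by move=> a c ea ec; rewrite !rmorphM (derM hD) rmorphD !rmorphM ea ec (derM hD).
move=> a ea; have [->|a0] := eqVneq a 0; first by rewrite invr0 (der0 hD) rmorph0 (der0 hD).
rewrite (derV hD a0) rmorphM rmorphN fmorphV rmorphXn ea fmorphV (derV hD) //.
by rewrite fmorph_eq0.
Qed.

Section Solution.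
Variables (u v : F) (a b : nat).
Hypothesis huv : L1.@[u] * L2.@[v] = 1.
Hypothesis ha : (a <= q - 2)%N.
Hypothesis hb : (b <= q - 2)%N.

Let g := u ^+ a * v ^+ b * D u * L2.@[v].

Let tau_sol c : c \in roots2 hC -> L1.@[tau hC c u] * L2.@[tau hC c v] = 1.
Proof.
move=> /tauP [tK _ _].
by rewrite -!(rmorph_horner _ _ tK) -rmorphM huv rmorph1.
Qed.

Let tau_g c : c \in roots2 hC -> tau hC c g =
  tau hC c u ^+ a * tau hC c v ^+ b * D (tau hC c u) * L2.@[tau hC c v].
Proof.
move=> cr; have [tK _ _] := tauP cr.
by rewrite /g !rmorphM !rmorphXn (rmorph_horner _ _ tK) tau_der.
Qed.

(** Each conjugate of [(u, v)] is again a solution of the equation, so [val_differential] bounds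
    every term of the trace in the same ring; [O] need not be stable under the translations. *)
Let trace_sub O e : is_subring iota O -> (forall z, O z \/ O z^-1) ->
    (forall z, O z -> exists2 o, O o & D z = e * o) ->
  exists2 o, O o & trace hC g = e * o.
Proof.
move=> hS hV hDO; have [e0|e0] := eqVneq e 0.
  exists 0; first exact: subring0 hS.
  rewrite mulr0 /trace big_seq big1 // => c cr; rewrite (tau_g cr).
  have [o _ ->] := val_differential hS hV q1 hL1 hL2 hD hDO (tau_sol cr) ha hb.
  by rewrite e0 mul0r.
exists (e^-1 * trace hC g); last by rewrite mulVKf.
rewrite /trace mulr_sumr; apply: (subring_sum hS) => c cr; rewrite (tau_g cr).
have [o Oo ->] := val_differential hS hV q1 hL1 hL2 hD hDO (tau_sol cr) ha hb.
by rewrite mulKf.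
Qed.

(* Expand the trace argument in powers of [1 / y]: the terms [y ^ k] with
   [k < q - 1] have trace 0, so only a multiple of [1 / y] remains. *)
Let trace_pole alpha : L1.[alpha] = 0 -> exists O, exists2 o,
  [/\ local_ring iota O y^-1, O o & exists2 o, O o & x = iota alpha + y^-1 * o]
  & trace hC g = y^-1 * o.
Proof.
move=> La; have y0 := curve_y_neq0 hC.
have [O [hO hV hDO hT hx]] := pole_chart hC hD hDx hDy La.
have hS := loc_sub hO; have Os := loc_t hO.
exists O.
have step n : (n <= q.-1)%N ->
  exists2 o, O o & trace hC g = trace hC (y ^+ (q - 2) * y^-1 ^+ n * o).
  elim: n => [_|n IH nq].
    have [o Oo gE] := val_differential hS hV q1 hL1 hL2 hD hDO huv ha hb.
    by exists o; rewrite // /g gE mulr1.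
  have [o Oo ->] := IH (ltnW nq); have [c [o' Oo' ->]] := loc_res hO Oo.
  exists o' => //; rewrite mulrDr traceD.
  have -> : y ^+ (q - 2) * y^-1 ^+ n * iota c = iota c * y ^+ (q - 2 - n).
    have nq2 : (n <= q - 2)%N by lia.
    rewrite mulrC -{1}(subnK nq2) exprD; congr (_ * _).
    by rewrite -mulrA -exprMn mulfV // expr1n mulr1.
  rewrite traceZ trace_yn ?mulr0 ?add0r; last by lia.
  by congr (trace _ _); rewrite exprSr; ring.
have [o Oo ->] := step _ (leqnn _).
have -> : y ^+ (q - 2) * y^-1 ^+ q.-1 * o = y^-1 * o.
  have -> : q.-1 = (q - 2).+1 by lia.
  by rewrite exprS mulrCA -exprMn mulfV // expr1n mulr1.
(* This ring is stable under translations and [y / (y + c)] is a unit in it, so [y] times each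
   conjugate of [o / y] lies in it. *)
exists (y * trace hC (y^-1 * o)); last by rewrite mulKf.
split=> //; rewrite /trace mulr_sumr; apply: (subring_sum hS) => c cr.
have [tK _ ty] := tauP cr.
rewrite rmorphM fmorphV ty mulrA; apply: (subring_mul hS).
  have -> : y / (y + iota c) = (iota 1 + y^-1 * iota c)^-1.
    rewrite rmorph1; have -> : 1 + y^-1 * iota c = y^-1 * (y + iota c).
      by rewrite mulrDr mulVf.
    by rewrite invfM invrK.
  by apply: (loc_unit_res hO (oner_neq0 _)); apply: subring_const hS _.
by apply: hT Oo; apply: tauP.
Qed.

(* As a rational function of [x], the trace has no pole, vanishes at the [q]
   roots of [L1], and has degree at most [q - 2] at infinity. *)
Lemma trace_differential : trace hC g = 0.
Proof.
have [A [B [AB B0 rE]]] := in_Kx_coprime (curve_transc hC) (trace_in_Kx hC g).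
have nz C : C != 0 -> C.@[x] != 0 by apply: contra_neq => /(curve_transc hC).
have Bx0 := nz _ B0.
have cong O t c o (P : {poly K}) : local_ring iota O t -> O o -> x = iota c + t * o ->
    exists2 o', O o' & P.@[x] = iota P.[c] + t * o'.
  move=> hO Oo xE; have hS := loc_sub hO.
  have := subring_eval_cong hS P%:P (loc_t hO) Oo Oo xE (esym (erefl (iota c + t * o))).
  by rewrite !evalC map_poly_id.
(* Otherwise [A(x)] is a unit at the point over [alpha], and [A / B = o / y] gives [y = o B / A] in
   the ring, although [1 / y] is its uniformizer. *)
have Aroot alpha : L1.[alpha] = 0 -> A.[alpha] = 0.
  move=> La; have [O [o [hO Oo [o' Oo' xE]] rE']] := trace_pole La.
  have hS := loc_sub hO.
  have [oA OA AE] := cong O _ alpha o' A hO Oo' xE.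
  have [oB OB BE] := cong O _ alpha o' B hO Oo' xE.
  apply/eqP; have [//|A0] := eqVneq A.[alpha] 0.
  case: (loc_tV hO); have := loc_unit_res hO A0 OA; rewrite -AE => OAV.
  have t0 := loc_t_neq0 hO.
  have -> : y^-1^-1 = o * B.@[x] * (A.@[x])^-1.
    have -> : A.@[x] = y^-1 * o * B.@[x] by rewrite -rE' rE divfK.
    have o0 : o != 0.
      apply: contraNneq A0 => o0; have : A.@[x] = 0.
        by rewrite -(divfK Bx0 A.@[x]) -rE rE' o0 mulr0 mul0r.
      by move/(curve_transc hC) ->; rewrite horner0.
    by move: t0; rewrite invr_eq0 => y0; field; rewrite ?o0 ?Bx0 ?y0 ?oner_neq0.
  apply: (subring_mul hS) => //; apply: (subring_mul hS) => //; rewrite BE.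
  apply: (subring_add hS); first exact: subring_const hS _.
  by apply: (subring_mul hS) => //; apply: loc_t hO.
(* A root [c] of [B] is not a root of [A], hence not of [L1] by [Aroot]. It is therefore the
   abscissa of an affine point, where the trace is regular, which contradicts the pole. *)
have Bconst : size B = 1%N.
  apply/eqP; apply: contraT => /closed_rootP [c Bc].
  have A0 : A.[c] != 0 by apply: (coprimep_root _ Bc); rewrite coprimep_sym.
  have La : L1.[c] != 0 by apply: contraNneq A0 => /Aroot ->.
  have [d Ld] : exists d, L2.[d] = L1.[c]^-1.
    have : size (L2 - (L1.[c]^-1)%:P) != 1%N.
      rewrite size_polyDl (lin_size hL2); first by rewrite eqSS -lt0n ltnW.
      by rewrite size_polyN (leq_ltn_trans (size_polyC_leq1 _)) // ltnS ltnW.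
    case/closed_rootP => d; rewrite rootE hornerD hornerN hornerC subr_eq0 => /eqP.
    by exists d.
  have cd : L1.[c] * L2.[d] = 1 by rewrite Ld mulfV.
  have [O [hO hV hDO]] := affine_chart hC hD hDx hDy cd.
  have hS := loc_sub hO.
  have [r Or rE'] := trace_sub hS hV hDO; rewrite mul1r in rE'.
  have xE : x = iota c + (x - iota c) * 1 by rewrite mulr1 addrC subrK.
  have [oA OA AE] := cong O _ c 1 A hO (subring1 hS) xE.
  have [oB OB BE] := cong O _ c 1 B hO (subring1 hS) xE.
  rewrite (eqP Bc) rmorph0 add0r in BE.
  have := loc_unit_res hO A0 OA; rewrite -AE => OAV.
  case: (loc_tV hO); have t0 := loc_t_neq0 hO.
  have rAB : A.@[x] = r * ((x - iota c) * oB) by rewrite -BE -rE' rE divfK.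
  have Ax0 : A.@[x] != 0 by apply: nz; apply: contraNneq A0 => ->; rewrite horner0.
  have -> : (x - iota c)^-1 = r * oB * (A.@[x])^-1.
    move: Ax0; rewrite rAB !mulf_eq0 !negb_or => /andP [r0 /andP [_ o0]].
    by field; rewrite ?r0 ?o0 ?t0.
  by apply: (subring_mul hS) => //; apply: (subring_mul hS).
have /size_poly1P [k k0 BE] := introT eqP Bconst.
rewrite BE map_polyC hornerC in rE.
have Lr := lin_roots hL1; case: Lr => rs [urs szrs mem_rs _].
have [A0|A0] := eqVneq A 0; first by rewrite rE A0 rmorph0 horner0 mul0r.
have szA : (q < size A)%N.
  rewrite -szrs; apply: max_poly_roots => //.
  by apply/allP => alpha; rewrite mem_rs rootE => /eqP /Aroot ->.
have [beta Lb] : exists beta, L2.[beta] = 0 by exists 0; apply: lin0 hL2.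
(* At a pole of [x] the trace lies in [x^(q-2) O], whereas a nonzero [A] has at least the [q] roots
   of [L1], hence degree [n >= q]. *)
have [O [hO hV hDO _ _]] := pole_chart (curve_swap hC) hD hDy hDx Lb.
have hS := loc_sub hO.
have [o Oo rE'] := trace_sub hS hV hDO.
have x0 : x != 0 := curve_y_neq0 (curve_swap hC).
pose n := (size A).-1.
have nE : size A = n.+1 by rewrite prednK // size_poly_gt0.
have sA : (size A <= n.+1)%N by rewrite nE.
have [R hR] := rev_poly iota sA.
have lcA : A`_n != 0 by rewrite /n -lead_coefE lead_coef_eq0.
have OR : O R.@[x^-1] by apply: (subring_horner hS); apply: loc_t hO.
have := loc_unit_res hO lcA OR; set w := iota A`_n + _ => OwV.
have w0 : w != 0.
  by have := nz _ A0; rewrite hR // -/w mulf_eq0 negb_or => /andP [].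
case: (loc_tV hO).
have ik0 : iota k != 0 by rewrite fmorph_eq0.
have e1 : x ^+ n * w = x ^+ (q - 2) * (o * iota k).
  by rewrite /w -hR // -(divfK ik0 A.@[x]) -rE rE' mulrA.
have qn : (q <= n)%N by rewrite -ltnS -nE.
have e2 : x ^+ (n - q).+2 * w = o * iota k.
  apply: (mulfI (_ : x ^+ (q - 2) != 0)); first by rewrite expf_neq0.
  by rewrite -e1 mulrA -exprD subn2_addSS.
have -> : x^-1^-1 = x^-1 ^+ (n - q).+1 * (o * iota k) * w^-1.
  rewrite -e2 invrK; set l := (n - q).+1.
  by rewrite mulrA mulfK // (exprSr x) mulrA -exprMn mulVf // expr1n mul1r.
apply: (subring_mul hS) => //; apply: (subring_mul hS); last first.
  by apply: (subring_mul hS) => //; apply: subring_const hS _.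
by apply: (subringX hS); apply: loc_t hO.
Qed.

End Solution.

End TraceOfDifferentials.

(** * Automorphisms and the two rulings *)

Section DependentPoints.
Variables (I : eqType) (F : fieldType) (n : nat) (r : seq I) (i0 : I) (U V W : I -> F).
Hypothesis n2 : (2 < n)%N.
Hypothesis ur : uniq r.
Hypothesis szr : size r = n.
Hypothesis i0r : i0 \in r.
Hypothesis W0 : W i0 != 0.
Hypothesis dep : forall a b, (a <= n - 2)%N -> (b <= n - 2)%N ->
  \sum_(i <- r) W i * U i ^+ a * V i ^+ b = 0.

Lemma dependent_horner (P Q : {poly F}) : (size P <= n.-1)%N -> (size Q <= n.-1)%N ->
  \sum_(i <- r) W i * P.[U i] * Q.[V i] = 0.
Proof.
move=> sP sQ.
under eq_bigr => i _.
  rewrite (horner_coef_wide (U i) sP) (horner_coef_wide (V i) sQ).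
  rewrite -mulrA big_distrlr /= mulr_sumr.
  under eq_bigr => j _ do rewrite mulr_sumr.
  over.
rewrite exchange_big /= big1 // => j _; rewrite exchange_big /= big1 // => k _.
transitivity (P`_j * Q`_k * \sum_(i <- r) W i * U i ^+ j * V i ^+ k).
  by rewrite mulr_sumr; apply: eq_bigr => i _; ring.
by rewrite dep ?mulr0 //; [have := ltn_ord j | have := ltn_ord k]; move: n2; lia.
Qed.

(** The product of the linear factors [X - s] and [Y - t] would vanish at every point but the one of
    index [i0], whose weight is nonzero. *)
Lemma dependent_cover (S T : seq F) : (size S <= n - 2)%N -> (size T <= n - 2)%N ->
    U i0 \notin S -> V i0 \notin T ->
  ~ (forall i, i \in r -> i != i0 -> (U i \in S) || (V i \in T)).
Proof.
move=> sS sT US VT cover.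
pose P (R : seq F) : {poly F} := \prod_(z <- R) ('X - z%:P).
have rootP R z : ((P R).[z] == 0) = (z \in R) by rewrite -rootE root_prod_XsubC.
have szP R : (size R <= n - 2)%N -> (size (P R) <= n.-1)%N.
  by rewrite size_prod_XsubC; move: n2; lia.
have := dependent_horner (szP _ sS) (szP _ sT).
rewrite (bigD1_seq i0) //= big_seq_cond big1 => [|i /andP [ir ii0]]; last first.
  by case/orP: (cover i ir ii0); rewrite -rootP => /eqP ->; rewrite ?mulr0 ?mul0r.
by rewrite addr0 => /eqP; rewrite !mulf_eq0 (negPf W0) !rootP (negPf US) (negPf VT).
Qed.

(** [A] and [B] collect the other points off and on the line [U = U i0]. If both are nonempty, the
    [U]-values of [A] and the [V]-values of [B] cover all points but [i0]. If [B] is empty and some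
    [i1] has another [V]-value, cover [i1] by [V] and the rest by [U]; the single [V]-value fits
    since [n - 2 >= 1]. *)
Lemma dependent_ruling :
    (forall i, i \in r -> i != i0 -> U i = U i0 -> V i = V i0 -> False) ->
  (forall i, i \in r -> U i = U i0) \/ (forall i, i \in r -> V i = V i0).
Proof.
move=> dist; pose r' := rem i0 r.
have szr' : size r' = n.-1 by rewrite size_rem // szr.
have mem_r' i : (i \in r') = (i != i0) && (i \in r) by rewrite mem_rem_uniq // inE.
pose A := [seq i <- r' | U i != U i0]; pose B := [seq i <- r' | U i == U i0].
have szAB : (size A + size B = n.-1)%N.
  rewrite /A /B !size_filter addnC -szr'; exact: count_predC.
have notS (E : I -> F) (R : seq I) : (forall i, i \in R -> E i != E i0) -> E i0 \notin map E R.
  by move=> ne; apply/negP => /mapP [i /ne /eqP ii e]; apply: ii.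
have [A0|A0] := posnP (size A).
  left=> i ir; have [->//|ii0] := eqVneq i i0.
  have : i \notin A by rewrite (size0nil A0).
  by rewrite mem_filter mem_r' ii0 ir /= andbT negbK => /eqP.
have [B0|B0] := posnP (size B); last first.
  case: (@dependent_cover (map U A) (map V B)); rewrite ?size_map.
  - by move: szAB B0; lia.
  - by move: szAB A0; lia.
  - by apply: notS => i; rewrite mem_filter => /andP [].
  - apply: notS => i; rewrite mem_filter mem_r' => /and3P [/eqP UE ii0 ir].
    by apply/eqP => VE; apply: (dist i).
  move=> i ir ii0; have [UE|UE] := eqVneq (U i) (U i0); apply/orP; [right|left];
    by apply: map_f; rewrite mem_filter mem_r' ii0 ir UE ?eqxx.
have Une i : i \in r' -> U i != U i0.
  move=> ir; have : i \notin B by rewrite (size0nil B0).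
  by rewrite mem_filter ir andbT.
have [/hasP [i1 i1r V1]|/hasPn allV] := boolP (has (fun i => V i != V i0) r'); last first.
  right=> i ir; have [->//|ii0] := eqVneq i i0.
  by have := allV i; rewrite mem_r' ii0 ir /= negbK => /(_ isT) /eqP.
case: (@dependent_cover (map U (rem i1 r')) [:: V i1]).
- by rewrite size_map size_rem // szr'; move: n2; lia.
- by move: n2 => /=; lia.
- by apply: notS => i /mem_rem /Une.
- by rewrite inE eq_sym.
move=> i ir ii0; have [->|ii1] := eqVneq i i1; first by rewrite mem_head orbT.
by apply/orP; left; apply: map_f; rewrite mem_rem_uniq ?rem_uniq // inE ii1 mem_r' ii0.
Qed.

End DependentPoints.

Section RationalSubfield.
Variables (K F : fieldType) (iota : {rmorphism K -> F}).
Local Notation "P .@[ z ]" := (map_poly iota P).[z] (at level 2, format "P .@[ z ]").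
Local Notation in_Kx := (in_Kx iota).
Local Notation transc := (transc iota).

Lemma in_Kx_horner u (A : {poly K}) : in_Kx u A.@[u].
Proof. by exists A, 1; rewrite oner_neq0 rmorph1 hornerC divr1. Qed.

Lemma in_Kx_sub u : transc u -> is_subring iota (in_Kx u).
Proof.
move=> tu; have nz C : C != 0 -> C.@[u] != 0 by apply: contra_neq => /tu.
split.
- by move=> c; have := in_Kx_horner u c%:P; rewrite map_polyC hornerC.
- move=> _ _ [A [B [B0 ->]]] [A' [B' [B'0 ->]]].
  exists (A * B' + A' * B), (B * B'); rewrite mulf_neq0 //; split=> //.
  by rewrite rmorphD !rmorphM hornerD !hornerM; field; rewrite !nz.
move=> _ _ [A [B [B0 ->]]] [A' [B' [B'0 ->]]].
exists (A * A'), (B * B'); rewrite mulf_neq0 //; split=> //.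
by rewrite !rmorphM !hornerM mulf_div.
Qed.

Lemma in_Kx_inv u z : in_Kx u z -> in_Kx u z^-1.
Proof.
case=> A [B [B0 ->]]; have [->|A0] := eqVneq A 0.
  by exists 0, 1; rewrite oner_neq0 rmorph0 horner0 !mul0r invr0.
by exists B, A; rewrite invf_div.
Qed.

Lemma in_Kx_trans u v w : transc u -> in_Kx u v -> in_Kx v w -> in_Kx u w.
Proof.
move=> tu uv [A [B [B0 ->]]]; have hS := in_Kx_sub tu.
by apply: (subring_mul hS); [|apply: in_Kx_inv]; apply: (subring_horner hS).
Qed.

Lemma in_Kx_rmorph (s : {rmorphism F -> F}) u z : (forall c, s (iota c) = iota c) ->
  in_Kx u z -> in_Kx (s u) (s z).
Proof.
move=> sK [A [B [B0 ->]]]; exists A, B; split=> //.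
by rewrite rmorphM fmorphV !(rmorph_horner _ _ sK).
Qed.

End RationalSubfield.

Section Pencils.
Variables (K : closedFieldType) (F : fieldType) (iota : {rmorphism K -> F}).
Variables (q : nat) (L1 L2 : {poly K}) (x y : F).

Local Notation "P .@[ z ]" := (map_poly iota P).[z] (at level 2, format "P .@[ z ]").
Local Notation in_Kx := (in_Kx iota).

Lemma aut_in_Kx (s : {rmorphism F -> F}) : curve iota q L1 L2 x y ->
  is_curve_aut iota s -> in_Kx x (s x) \/ in_Kx x (s y).
Proof.
move=> hC [[s' sK' s'K] sK].
have hL1 := curve_lin1 hC; have hL2 := curve_lin2 hC; have q2 := curve_q hC.
have [|D [hD Dx Dy]] := curve_derivation hC
    (dx := iota L2`_1 * L1.@[x]) (dy := iota (- L1`_1) * L2.@[y]).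
  by rewrite rmorphN; ring.
have huv : L1.@[s x] * L2.@[s y] = 1.
  by rewrite -!(rmorph_horner _ _ sK) -rmorphM (curve_eq hC) rmorph1.
have [u0 v0] := mul_eq1_neq0 huv.
(* If [D] killed [s x], it would kill [s y] by the equation, hence the image of [s], which is all of
   [F]; but [D x] is nonzero. *)
have Du0 : D (s x) != 0.
  apply/eqP => Du.
  have Dv : D (s y) = 0.
    have := der_sol hL1 hL2 hD huv; rewrite Du mulr0 mul0r => /esym/eqP.
    rewrite oppr_eq0 !mulf_eq0 fmorph_eq0 (negPf (lin_coef1 hL2)) (negPf u0) orbF /=.
    by move/eqP.
  have Ds z : D (s z) = 0.
    move: z; apply: (curve_ind hC) => //.
    - by move=> c; rewrite sK (derK hD).
    - by move=> a b ea eb; rewrite rmorphD (derD hD) ea eb addr0.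
    - by move=> a b ea eb; rewrite rmorphM (derM hD) ea eb mul0r mulr0 addr0.
    move=> a ea; rewrite fmorphV; have [->|a0] := eqVneq (s a) 0.
      by rewrite invr0 (der0 hD).
    by rewrite (derV hD a0) ea oppr0 mul0r.
  have := Ds (s' x); rewrite s'K Dx => /eqP.
  rewrite mulf_eq0 fmorph_eq0 (negPf (lin_coef1 hL2)) /= => /eqP /(curve_transc hC) /eqP.
  by rewrite (negPf (lin_neq0 hL1)).
have r0 : 0 \in roots2 hC by rewrite mem_roots2 (lin0 hL2).
have tau0 : tau hC 0 =1 idfun.
  have [tK tx ty] := tauP r0.
  by apply: (curve_morph_eq hC) => //=; rewrite ty rmorph0 addr0.
pose w := D (s x) * L2.@[s y].
case: (@dependent_ruling _ F q (roots2 hC) 0 (fun b => tau hC b (s x))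
     (fun b => tau hC b (s y)) (fun b => tau hC b w)) => //.
- exact: roots2_uniq.
- exact: roots2_size.
- by rewrite tau0 mulf_neq0.
- move=> a b ha hb; rewrite -[RHS](trace_differential hC hD Dx Dy huv ha hb).
  apply: eq_bigr => c _; rewrite -!rmorphXn -!rmorphM; congr (tau _ _ _).
  by rewrite /w; ring.
(* If the translation by [b] fixes [s x] and [s y], it fixes the image of [s], which contains [y];
   so [b = 0]. *)
- move=> b br b0 xE yE; have [tK tx ty] := tauP br.
  have ts z : tau hC b (s z) = s z.
    move: z; apply: (curve_ind hC).
    - by move=> c; rewrite sK tK.
    - by rewrite xE tau0.
    - by rewrite yE tau0.
    - by move=> a c ea ec; rewrite !rmorphD ea ec.
    - by move=> a c ea ec; rewrite !rmorphM ea ec.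
    by move=> a ea; rewrite !fmorphV ea.
  have := ts (s' y); rewrite s'K ty => /eqP; rewrite -subr_eq0 addrAC subrr add0r.
  by rewrite fmorph_eq0 (negPf b0).
- by move=> fx; left; apply: (trace_fixed (hC := hC)) => b br; rewrite fx // tau0.
- by move=> fy; right; apply: (trace_fixed (hC := hC)) => b br; rewrite fy // tau0.
Qed.

(** The translation by a nonzero root of [L2] fixes K(x) and moves [y]. *)
Lemma curve_y_notin_Kx : curve iota q L1 L2 x y -> ~ in_Kx x y.
Proof.
move=> hC [A [B [B0 e]]]; have q2 := curve_q hC.
have [b br b0] : exists2 b, b \in roots2 hC & b != 0.
  have u := roots2_uniq hC; have sz := roots2_size hC.
  case: (roots2 hC) u sz => [|a [|c r]] u sz; try by rewrite -sz in q2.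
  have [a0|a0] := eqVneq a 0; last by exists a; rewrite ?mem_head.
  exists c; first by rewrite !inE eqxx orbT.
  by apply: contraTneq u => c0; rewrite /= inE a0 c0 eqxx.
have [tK tx ty] := tauP br.
have : tau hC b (A.@[x] / B.@[x]) = A.@[x] / B.@[x].
  by rewrite rmorphM fmorphV !(rmorph_horner _ _ tK) tx.
rewrite -e ty => /eqP; rewrite -subr_eq0 addrAC subrr add0r.
by rewrite fmorph_eq0 (negPf b0).
Qed.

End Pencils.

Lemma rmorph_inverse (F : fieldType) (s : {rmorphism F -> F}) (s' : F -> F) :
  cancel s s' -> cancel s' s -> {t : {rmorphism F -> F} | t =1 s'}.
Proof.
move=> sK s'K.
pose sa := GRing.isZmodMorphism.Build F F s' (can2_zmod_morphism sK s'K).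
pose sm := GRing.isMonoidMorphism.Build F F s' (can2_monoid_morphism sK s'K).
pose S : {rmorphism F -> F} := HB.pack s' sa sm.
by exists S.
Qed.

Section AutPencils.
Variables (K : closedFieldType) (F : fieldType) (iota : {rmorphism K -> F}).
Variables (q : nat) (L1 L2 : {poly K}) (x y : F).
Hypothesis hC : curve iota q L1 L2 x y.
Local Notation in_Kx := (in_Kx iota).

(** [aut_in_Kx] is applied to [s] and to its inverse, and with [x], [y] exchanged. A mixed answer
    puts [s x] or [s y] in both K(x) and K(y); the subfield it generates contains [x] or [y], so one
    coordinate would be rational in the other. *)
Lemma aut_pencils (s : {rmorphism F -> F}) : is_curve_aut iota s ->
  [/\ in_Kx x (s x), in_Kx (s x) x, in_Kx y (s y) & in_Kx (s y) y] \/
  [/\ in_Kx x (s y), in_Kx (s y) x, in_Kx y (s x) & in_Kx (s x) y].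
Proof.
move=> hs; have [[s' sK' s'K] sK] := hs.
have [t tE] := rmorph_inverse sK' s'K.
have tK c : t (iota c) = iota c by rewrite tE -{1}(sK c) sK'.
have ht : is_curve_aut iota t.
  by split=> //; exists s => z; rewrite tE ?s'K ?sK'.
have hC' := curve_swap hC.
have push z w : in_Kx z (t w) -> in_Kx (s z) w.
  by move/(in_Kx_rmorph sK); rewrite tE s'K.
have tx : transc iota x := curve_transc hC.
have ty : transc iota y := curve_transc hC'.
have yx := curve_y_notin_Kx hC; have xy := curve_y_notin_Kx hC'.
have tr := @in_Kx_trans K F iota.
have txV : in_Kx (s x) x \/ in_Kx (s x) y.
  by case: (aut_in_Kx hC ht) => /push; [left|right].
have tyV : in_Kx (s y) y \/ in_Kx (s y) x.
  by case: (aut_in_Kx hC' ht) => /push; [left|right].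
case: (aut_in_Kx hC hs) => hx; case: (aut_in_Kx hC' hs) => hy.
- left; split=> //.
  + by case: txV => // /(tr _ _ _ tx hx).
  + by case: tyV => // /(tr _ _ _ ty hy).
- case: txV; first by move/(tr _ _ _ ty hy).
  by move/(tr _ _ _ tx hx).
- case: tyV; first by move/(tr _ _ _ tx hx).
  by move/(tr _ _ _ ty hy).
- right; split=> //.
  + by case: tyV => // /(tr _ _ _ tx hx).
  + by case: txV => // /(tr _ _ _ ty hy).
Qed.

End AutPencils.

(** * Moebius transformations and the equation of the curve *)

(* Rational root theorem: [x = A(u) / B(u)] makes [u = C(x) / D(x)] a root of
   [x B(T) - A(T)], whose coefficients have degree at most 1 in [x]; hence [C]
   divides the constant coefficient and [D] the leading one. *)
Lemma mutually_rational_size (K F : fieldType) (iota : {rmorphism K -> F}) (x u : F) :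
    transc iota x -> transc iota u -> in_Kx iota x u -> in_Kx iota u x ->
  exists C D : {poly K}, [/\ (size C <= 2)%N, (size D <= 2)%N, D != 0
     & u = (map_poly iota C).[x] / (map_poly iota D).[x]].
Proof.
move=> tx tu xu ux.
have [C [D [CD D0 uE]]] := in_Kx_coprime tx xu.
have [A [B [AB B0 xE]]] := in_Kx_coprime tu ux.
have Dx0 : (map_poly iota D).[x] != 0 by apply: contraNneq D0 => /tx ->.
have Bu0 : (map_poly iota B).[u] != 0 by apply: contraNneq B0 => /tu ->.
pose n := (maxn (size A) (size B)).-1.
have nE : n.+1 = maxn (size A) (size B).
  by rewrite prednK // leq_max orbC size_poly_gt0 B0.
pose E i : {poly K} := (A`_i)%:P - B`_i *: 'X.
have Ex i : (map_poly iota (E i)).[x] = iota A`_i - iota B`_i * x.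
  by rewrite rmorphB /= linearZ /= map_polyC map_polyX hornerD hornerN hornerC hornerZ hornerX.
have E0P i : (A`_i != 0) || (B`_i != 0) -> E i != 0.
  apply: contraTneq => Ei; have := congr1 (fun p : {poly K} => p`_0) Ei.
  have := congr1 (fun p : {poly K} => p`_1) Ei.
  rewrite !coef0 !coefB !coefC !coefZ !coefX /= mulr0 mulr1 sub0r subr0.
  by move=> /eqP; rewrite oppr_eq0 => /eqP -> ->; rewrite eqxx.
have szE i : (size (E i) <= 2)%N.
  rewrite (leq_trans (size_polyD _ _)) // geq_max size_polyN.
  rewrite (leq_trans (size_polyC_leq1 _)) //=.
  by rewrite (leq_trans (size_scale_leq _ _)) // size_polyX.
have sum0 : \sum_(i < n.+1) E i * C ^+ i * D ^+ (n - i) = 0.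
  apply: tx; rewrite rmorph_sum horner_sum.
  transitivity ((map_poly iota D).[x] ^+ n *
      ((map_poly iota A).[u] - x * (map_poly iota B).[u])); last first.
    by rewrite [X in X * (map_poly iota B).[u]]xE divfK // subrr mulr0.
  have wide (P : {poly K}) : (size P <= n.+1)%N ->
    (map_poly iota P).[u] = \sum_(i < n.+1) iota P`_i * u ^+ i.
    move=> sP; rewrite (@horner_coef_wide _ n.+1) ?(leq_trans (size_poly _ _)) //.
    by apply: eq_bigr => i _; rewrite coef_map.
  rewrite !wide ?nE ?leq_maxl ?leq_maxr // [x * _]mulr_sumr -sumrB mulr_sumr.
  rewrite -nE; apply: eq_bigr => i _; rewrite !rmorphM !rmorphXn /= !hornerM !horner_exp Ex.
  have -> : (map_poly iota D).[x] ^+ n =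
      (map_poly iota D).[x] ^+ (n - i) * (map_poly iota D).[x] ^+ i.
    by rewrite -exprD subnK // -ltnS.
  by rewrite uE expr_div_n; field; rewrite expf_neq0.
exists C, D; split=> //.
  have : C %| E 0%N.
    rewrite -(@Gauss_dvdpl _ _ (D ^+ n)) ?coprimep_expr //.
    move: sum0; rewrite big_ord_recl expr0 mulr1 subn0 => /eqP.
    rewrite addr_eq0 => /eqP ->; rewrite dvdpNr.
    apply: (big_ind (fun p => C %| p)); [exact: dvdp0 | by move=> *; apply: dvdp_add|].
    by move=> i _; rewrite lift0 exprS mulrCA -mulrA dvdp_mulr.
  move=> /dvdp_leq le; rewrite (leq_trans (le _)) // E0P // -negb_and.
  apply: contraL AB => /andP [/eqP A0 /eqP B00].
  have r0 : root A 0 by rewrite rootE horner_coef0 A0.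
  by apply/negP => AB0; have := coprimep_root AB0 r0; rewrite horner_coef0 B00 eqxx.
have : D %| E n.
  rewrite -(@Gauss_dvdpl _ _ (C ^+ n)) ?coprimep_expr 1?coprimep_sym //.
  move: sum0; rewrite big_ord_recr /= subnn expr0 mulr1 => /eqP.
  rewrite addrC addr_eq0 => /eqP ->; rewrite dvdpNr.
  apply: (big_ind (fun p => D %| p)); [exact: dvdp0 | by move=> *; apply: dvdp_add|].
  by move=> i _; rewrite dvdp_mull // -(subnSK (ltn_ord i)) exprS dvdp_mulr.
move=> /dvdp_leq le; rewrite (leq_trans (le _)) // E0P //.
have lead (P : {poly K}) : n.+1 = size P -> P`_n != 0.
  by move=> e; rewrite -[n]/(n.+1.-1) e -lead_coefE lead_coef_eq0 -size_poly_eq0 -e.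
move: nE; rewrite maxnE; case: (leqP (size A) (size B)) => [AleB|BltA].
  by rewrite subnKC // => /lead ->; rewrite orbT.
by have -> : (size B - size A = 0)%N; [lia | rewrite addn0 => /lead ->].
Qed.

Section Rigidity.
Variables (K : closedFieldType) (F : fieldType) (iota : {rmorphism K -> F}).
Variables (q : nat) (L1 L2 : {poly K}) (x y : F).
Hypothesis hC : curve iota q L1 L2 x y.
Hypothesis frobenius : forall a b : {poly K}, (a + b) ^+ q = a ^+ q + b ^+ q.

Local Notation ev := (eval_XY iota).
Local Notation "P .@[ z ]" := (map_poly iota P).[z] (at level 2, format "P .@[ z ]").
Local Notation f := (curve_poly L1 L2).

Let hL1 := curve_lin1 hC.
Let hL2 := curve_lin2 hC.
Let q2 := curve_q hC.

Lemma size2_poly (D : {poly K}) : (size D <= 2)%N -> D = (D`_0)%:P + (D`_1)%:P * 'X.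
Proof.
move=> sD; apply/polyP => i; rewrite coefD coefC coefMX coefC.
case: i => [|[|i]] /=; rewrite ?addr0 ?add0r //.
by apply: nth_default; apply: leq_trans sD _.
Qed.

Lemma coef1_expq (D : {poly K}) : (size D <= 2)%N -> (D ^+ q)`_1 = 0.
Proof.
move=> /size2_poly ->; rewrite frobenius exprMn -!rmorphXn /= coefD coefC coefCM coefXn /=.
by rewrite add0r (ltn_eqF (ltnW q2)) mulr0.
Qed.

Lemma size_expq (D : {poly K}) : (size D <= 2)%N -> (size (D ^+ q) <= q.+1)%N.
Proof.
move=> sD; rewrite (leq_trans (size_poly_exp_leq _ _)) // ltnS.
by rewrite -[leqRHS]mul1n leq_mul2r -subn1 leq_subLR sD orbT.
Qed.

(* [h] is a constant [k] by degrees.  Then compare the coefficients of [X]: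
   [D1 ^ q] and [D2 ^ q] have none, so [N1] and [N2] are proportional to [L1]
   and [L2] unless [k = 0]. *)
Lemma rigidity (N1 N2 D1 D2 : {poly K}) h :
    (size N1 <= q.+1)%N -> (size N2 <= q.+1)%N ->
    (size D1 <= 2)%N -> (size D2 <= 2)%N -> D1 != 0 -> D2 != 0 ->
    N1%:P * map_poly polyC N2 - (D1 ^+ q)%:P * map_poly polyC (D2 ^+ q) = h * f ->
  (exists c, N1 = c *: D1 ^+ q) \/
  (exists c1 c2, [/\ c1 != 0, c2 != 0, N1 = c1 *: L1, N2 = c2 *: L2
                   & size D1 = 1%N /\ size D2 = 1%N]).
Proof.
move=> sN1 sN2 sD1 sD2 D10 D20 e.
have szM (A B : {poly K}) : (size B <= q.+1)%N -> (size (A%:P * map_poly polyC B)%R <= q.+1)%N.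
  move=> sB; rewrite mul_polyC (leq_trans (size_scale_leq _ _)) //.
  exact: leq_trans (size_poly _ _) sB.
have coefM (A B : {poly K}) j : (A%:P * map_poly polyC B)`_j = B`_j *: A.
  by rewrite coefCM coef_map /= mulrC mul_polyC.
have sh : (size h <= 1)%N.
  have [->|h0] := eqVneq h 0; first by rewrite size_poly0.
  have : (size (h * f)%R <= q.+1)%N.
    rewrite -e (leq_trans (size_polyD _ _)) // size_polyN geq_max !szM //.
    exact: size_expq.
  rewrite size_mul ?(curve_poly_neq0 hC) // (curve_poly_size hC) addnS /=.
  by rewrite -[q.+1]add1n leq_add2r.
have coefe j : N2`_j *: N1 - (D2 ^+ q)`_j *: D1 ^+ q =
    h`_0 * (L2`_j *: L1 - (j == 0%N)%:R).
  have := congr1 (fun p : {poly {poly K}} => p`_j) e.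
  rewrite coefB !coefM => ->; rewrite {1}(size1_polyC sh) coefCM.
  by rewrite /curve_poly coefB coefM coef1.
have lcL2 := lin_lead hL2.
have sh0 : (size (h`_0)%R <= 1)%N.
  have [->|h0] := eqVneq h`_0 0; first by rewrite size_poly0.
  have : (size (h`_0 * (L2`_q *: L1))%R <= q.+1)%N.
    have := coefe q; rewrite (gtn_eqF (ltnW (ltnW q2))) subr0 => <-.
    rewrite (leq_trans (size_polyD _ _)) // size_polyN geq_max.
    rewrite !(leq_trans (size_scale_leq _ _)) //; exact: size_expq.
  rewrite -scalerAr size_scale // size_mul ?(lin_neq0 hL1) // (lin_size hL1) addnS /=.
  by rewrite -[q.+1]add1n leq_add2r.
set k := h`_0`_0.
have coefk j : N2`_j *: N1 - (D2 ^+ q)`_j *: D1 ^+ q =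
    k *: (L2`_j *: L1 - (j == 0%N)%:R).
  by rewrite coefe {1}(size1_polyC sh0) mul_polyC.
have D1q0 : D1 ^+ q != 0 by rewrite expf_neq0.
have D2q0 : D2 ^+ q != 0 by rewrite expf_neq0.
have [k0|k0] := eqVneq k 0.
  left; pose j := (size (D2 ^+ q)).-1.
  have lc : (D2 ^+ q)`_j != 0 by rewrite -lead_coefE lead_coef_eq0.
  have := coefk j; rewrite k0 scale0r => /eqP; rewrite subr_eq0 => /eqP ej.
  exists ((N2`_j)^-1 * (D2 ^+ q)`_j); rewrite -scalerA -ej scalerA mulVf ?scale1r //.
  apply: contra_eq_neq ej => ->; rewrite scale0r eq_sym scale_poly_eq0.
  by rewrite (negPf lc) (negPf D1q0).
right.
have e1 : N2`_1 *: N1 = (k * L2`_1) *: L1.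
  by have := coefk 1%N; rewrite (coef1_expq sD2) scale0r !subr0 scalerA.
have e2 : N1`_1 *: N2 = (k * L1`_1) *: L2.
  apply/polyP => j; rewrite !coefZ; have := congr1 (fun p : {poly K} => p`_1) (coefk j).
  rewrite coefB !coefZ (coef1_expq sD1) mulr0 subr0 coefB coefZ => /=.
  have -> : ((j == 0%N)%:R : {poly K})`_1 = 0.
    by case: (j == 0%N); rewrite ?coef0 // coef1.
  by rewrite subr0 mulrC => ->; ring.
have e3 : N1`_1 * N2`_1 = k * (L1`_1 * L2`_1).
  by have := congr1 (fun p : {poly K} => p`_1) e2; rewrite !coefZ mulrA.
have a10 := lin_coef1 hL1; have a20 := lin_coef1 hL2.
have : N1`_1 * N2`_1 != 0 by rewrite e3 !mulf_neq0.
rewrite mulf_eq0 negb_or => /andP [n1 n2].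
pose c1 := k * L2`_1 / N2`_1; pose c2 := k * L1`_1 / N1`_1.
have N1E : N1 = c1 *: L1.
  by rewrite /c1 mulrC -scalerA -e1 scalerA mulVf // scale1r.
have N2E : N2 = c2 *: L2.
  by rewrite /c2 mulrC -scalerA -e2 scalerA mulVf // scale1r.
have c12 : c1 * c2 = k.
  have -> : c1 * c2 = k * (k * (L1`_1 * L2`_1)) / (N1`_1 * N2`_1).
    by rewrite /c1 /c2; field; rewrite n1 n2.
  by rewrite -e3 mulfK // mulf_neq0.
(* After substitution of [N1] and [N2], what is left of the identity is [D1^q D2^q = k] with [k]
   nonzero, so both denominators are constant. *)
have coefD j : (D2 ^+ q)`_j *: D1 ^+ q = (k * (j == 0%N)%:R)%:P.
  have := coefk j; rewrite N1E {1}N2E coefZ scalerA scalerBr scalerA.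
  have -> : c2 * L2`_j * c1 = k * L2`_j by rewrite -c12; ring.
  by move=> /addrI /oppr_inj ->; case: (j == 0%N); rewrite ?mulr1 ?mulr0 ?alg_polyC ?scaler0.
have D1c : size (D1 ^+ q) = 1%N.
  have d0 : (D2 ^+ q)`_0 != 0.
    apply: contra_neq k0 => z; have := coefD 0%N; rewrite z scale0r mulr1 => /esym/eqP.
    by rewrite polyC_eq0 => /eqP.
  have := congr1 (fun p : {poly K} => size p) (coefD 0%N).
  by rewrite /= size_scale // mulr1 size_polyC k0.
have D2c : (size (D2 ^+ q) <= 1)%N.
  apply/leq_sizeP => j j0; have := coefD j; rewrite (gtn_eqF j0) mulr0 => /eqP.
  by rewrite polyC0 scale_poly_eq0 (negPf D1q0) orbF => /eqP.
have sz1 (D : {poly K}) : D != 0 -> (size (D ^+ q) <= 1)%N -> size D = 1%N.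
  move=> D0 sD; have := size_exp D q.
  have := size_poly_gt0 D; rewrite D0; case: (size D) => // n _ /=.
  have -> : (size (D ^+ q)).-1 = 0%N by move: sD; case: (size (D ^+ q)) => [|[]].
  move/esym/eqP; rewrite muln_eq0 => /orP [/eqP-> //|/eqP e0].
  by move: q2; rewrite e0.
exists c1, c2; split=> //.
- by rewrite !mulf_neq0 ?invr_eq0.
- by rewrite !mulf_neq0 ?invr_eq0.
by split; apply: sz1; rewrite ?D1c.
Qed.

Lemma homogenize (L C D : {poly K}) (z : F) : (size L <= q.+1)%N ->
    (size C <= 2)%N -> (size D <= 2)%N -> D.@[z] != 0 ->
  exists2 N : {poly K}, (size N <= q.+1)%N &
    N.@[z] = L.@[C.@[z] / D.@[z]] * (D ^+ q).@[z].
Proof.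
move=> sL sC sD D0; exists (\sum_(i < q.+1) L`_i *: (C ^+ i * D ^+ (q - i))).
  apply: (leq_trans (size_sum _ _ _)); apply/bigmax_leqP => i _.
  rewrite (leq_trans (size_scale_leq _ _)) // (leq_trans (size_polyMleq _ _)) //.
  have le (P : {poly K}) n : (size P <= 2)%N -> (size (P ^+ n) <= n.+1)%N.
    move=> sP; rewrite (leq_trans (size_poly_exp_leq _ _)) // ltnS.
    by rewrite -[leqRHS]mul1n leq_mul2r -subn1 leq_subLR sP orbT.
  have := le C i sC; have := le D (q - i)%N sD; have := ltn_ord i.
  set a := size _; set b := size _; lia.
rewrite rmorph_sum horner_sum rmorphXn horner_exp.
rewrite (@horner_coef_wide _ q.+1); last exact: leq_trans (size_poly _ _) sL.
rewrite mulr_suml; apply: eq_bigr => i _.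
rewrite /= linearZ /= hornerZ rmorphM !rmorphXn /= hornerM !horner_exp coef_map /=.
have -> : D.@[z] ^+ q = D.@[z] ^+ (q - i) * D.@[z] ^+ i.
  by rewrite -exprD subnK // -ltnS.
by rewrite expr_div_n; field; rewrite expf_neq0.
Qed.

(** The pair [(P1, P2)] will be [(L1, L2)] when the rulings are preserved and [(L2, L1)] when they
    are swapped. Clearing denominators gives a multiple of the equation, to which [rigidity]
    applies; nonconstancy of [P1(u)] excludes its first alternative. *)
Lemma mobius_solution (P1 P2 C1 D1 C2 D2 : {poly K}) (u v : F) :
    (size P1 <= q.+1)%N -> (size P2 <= q.+1)%N ->
    (size C1 <= 2)%N -> (size D1 <= 2)%N -> (size C2 <= 2)%N -> (size D2 <= 2)%N ->
    D1 != 0 -> D2 != 0 -> u = C1.@[x] / D1.@[x] -> v = C2.@[y] / D2.@[y] ->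
    P1.@[u] * P2.@[v] = 1 -> (forall c, P1.@[u] <> iota c) ->
  exists a b a' b' c c', [/\ u = iota a * x + iota b, v = iota a' * y + iota b',
     c != 0, P1.@[u] = iota c * L1.@[x] & P2.@[v] = iota c' * L2.@[y]].
Proof.
move=> sP1 sP2 sC1 sD1 sC2 sD2 D10 D20 uE vE uv nc.
have D1x : D1.@[x] != 0 by apply: contraNneq D10 => /(curve_transc hC) ->.
have D2y : D2.@[y] != 0 by apply: contraNneq D20 => /(curve_transc (curve_swap hC)) ->.
have [N1 sN1 N1E] := homogenize sP1 sC1 sD1 D1x.
have [N2 sN2 N2E] := homogenize sP2 sC2 sD2 D2y.
rewrite -uE in N1E; rewrite -vE in N2E.
have : ev x y (N1%:P * map_poly polyC N2 - (D1 ^+ q)%:P * map_poly polyC (D2 ^+ q)) = 0.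
  rewrite evalB !evalM !evalC !eval_map_polyC N1E N2E.
  rewrite -[(D1 ^+ q).@[x] * _ in X in _ - X]mul1r -uv; ring.
have D1qx : (D1 ^+ q).@[x] != 0 by rewrite rmorphXn horner_exp expf_neq0.
have D2qy : (D2 ^+ q).@[y] != 0 by rewrite rmorphXn horner_exp expf_neq0.
move/(curve_ker hC) => [h /(rigidity sN1 sN2 sD1 sD2 D10 D20)].
case=> [[c cE]|[c1 [c2 [c10 c20 N1L N2L [d1 d2]]]]].
  by case: (nc c); apply: (mulIf D1qx); rewrite -N1E cE linearZ /= hornerZ.
have [k1 k10 D1E] : exists2 k, k != 0 & D1 = k%:P by apply/size_poly1P; rewrite d1.
have [k2 k20 D2E] : exists2 k, k != 0 & D2 = k%:P by apply/size_poly1P; rewrite d2.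
have ik1 : iota k1 != 0 by rewrite fmorph_eq0.
have ik2 : iota k2 != 0 by rewrite fmorph_eq0.
have affine (C : {poly K}) k z : (size C <= 2)%N -> iota k != 0 ->
    C.@[z] / iota k = iota (C`_1 / k) * z + iota (C`_0 / k).
  move=> /size2_poly {1}-> k0.
  rewrite rmorphD rmorphM /= !map_polyC map_polyX hornerD hornerM hornerX !hornerC.
  by rewrite !rmorphM !fmorphV; field.
exists (C1`_1 / k1), (C1`_0 / k1), (C2`_1 / k2), (C2`_0 / k2), (c1 / k1 ^+ q), (c2 / k2 ^+ q).
split.
- by rewrite uE D1E map_polyC hornerC affine.
- by rewrite vE D2E map_polyC hornerC affine.
- by rewrite mulf_neq0 // invr_eq0 expf_neq0.
- apply: (mulIf D1qx); rewrite -N1E N1L linearZ /= hornerZ D1E -rmorphXn /= map_polyC hornerC.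
  by rewrite rmorphM fmorphV mulrAC divfK ?fmorph_eq0 ?expf_neq0.
apply: (mulIf D2qy); rewrite -N2E N2L linearZ /= hornerZ D2E -rmorphXn /= map_polyC hornerC.
by rewrite rmorphM fmorphV mulrAC divfK ?fmorph_eq0 ?expf_neq0.
Qed.

End Rigidity.

(** * Linearized polynomials *)

Lemma linearized_coef (K : fieldType) (r : nat) (L : {poly K}) i :
  linearized r L -> L`_i != 0 -> exists j, i = (r ^ j)%N.
Proof.
move=> [d [a ->]]; rewrite coef_sum => nz.
have /existsP [j /eqP ij] : [exists j : 'I_d, i == (r ^ j)%N].
  apply: contraNT nz => /existsPn ne; rewrite big1 // => j _.
  by rewrite coefZ coefXn (negPf (ne j)) mulr0.
by exists j.
Qed.

Lemma coef_linearized (K : fieldType) (r : nat) (L : {poly K}) : (1 < r)%N ->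
  (forall i, L`_i != 0 -> exists j, i = (r ^ j)%N) -> linearized r L.
Proof.
move=> r1 hL; exists (size L), (fun j => L`_(r ^ j)); apply/polyP => i.
rewrite coef_sum.
have [L0|L0] := eqVneq L`_i 0.
  rewrite L0 big1 // => j _; rewrite coefZ coefXn.
  by case: eqP => [<-|_]; rewrite ?L0 ?mul0r ?mulr0.
have [j ij] := hL i L0.
have jL : (j < size L)%N.
  rewrite (leq_trans (ltn_expl j r1)) // -ij ltnW //.
  by rewrite ltnNge; apply: contra L0 => /(nth_default 0) ->.
rewrite (bigD1 (Ordinal jL)) //= coefZ coefXn ij eqxx mulr1 big1 ?addr0 //.
move=> k kj; rewrite coefZ coefXn eqn_exp2l // eq_sym.
by move: kj; rewrite -val_eqE /= => /negPf ->; rewrite mulr0.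
Qed.

Section Characteristic.
Variables (p n : nat).
Hypothesis hp : prime p.
Hypothesis hn : (0 < n)%N.
Variables (K : fieldType) (emb : {rmorphism 'F_p -> K}).

Lemma pchar_emb (R : nzRingType) (f : {rmorphism K -> R}) : p \in [pchar R].
Proof. by apply: (rmorph_pchar f); apply: (rmorph_pchar emb); apply: pchar_Fp. Qed.

Lemma pchar_frobenius (R : comNzRingType) (f : {rmorphism K -> R}) j (a b : R) :
  (a + b) ^+ (p ^ j) = a ^+ (p ^ j) + b ^+ (p ^ j).
Proof.
apply: exprDn_pchar; rewrite (eq_pnat _ (pcharf_eq (pchar_emb f))).
by rewrite pnatX pnat_id.
Qed.

Lemma linearized_add (L : {poly K}) : linearized (p ^ n) L -> additive_poly L.
Proof.
move=> [d [a ->]] R f u v; rewrite !rmorph_sum !horner_sum -big_split /=.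
apply: eq_bigr => j _; rewrite linearZ /= !hornerZ map_polyXn !hornerXn -mulrDr.
by rewrite -expnM (pchar_frobenius f).
Qed.

Lemma linearized_lin_poly (q : nat) (L : {poly K}) : (0 < q)%N ->
  linearized (p ^ n) L -> separable_poly L -> size L = q.+1 -> lin_poly q L.
Proof.
move=> q0 hlin hsep sL; have hd : L^`() = (L`_1)%:P.
  apply/polyP => -[|i]; rewrite coef_deriv coefC //=.
  have [->|nz] := eqVneq L`_i.+2 0; first by rewrite mul0rn.
  have [[|j] ij] := linearized_coef hlin nz; first by rewrite expn0 in ij.
  have pK := pchar_emb (idfun : {rmorphism K -> K}).
  apply/eqP; rewrite -mulr_natr mulf_eq0 -(dvdn_pcharf pK) ij -expnM.
  by rewrite -(prednK (_ : 0 < n * j.+1)%N) ?muln_gt0 ?hn // expnS dvdn_mulr ?orbT.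
split=> //; first exact: linearized_add.
apply: contraTneq hsep => L1; rewrite separable_poly.unlock hd L1 polyC0.
by rewrite coprimep0 -size_poly_eq1 sL eqSS -lt0n.
Qed.

End Characteristic.

(** Transcendence of [x] lifts the identity to polynomials. Its value at 0 gives [P(b) = 0], and
    additivity of [P] in [{poly K}] then removes [b]. *)
Lemma lin_poly_comp (K F : fieldType) (iota : {rmorphism K -> F}) q (P L : {poly K}) x a b c :
    transc iota x -> lin_poly q P -> L.[0] = 0 ->
    (map_poly iota P).[iota a * x + iota b] = iota c * (map_poly iota L).[x] ->
  P.[b] = 0 /\ P \Po (a *: 'X) = c *: L.
Proof.
move=> tx hP L0 e.
have e' : P \Po (a *: 'X + b%:P) = c *: L.
  apply/eqP; rewrite -subr_eq0; apply/eqP/tx.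
  rewrite rmorphB /= hornerD hornerN map_comp_poly horner_comp linearZ /= hornerZ.
  rewrite rmorphD /= linearZ /= map_polyX map_polyC hornerD hornerZ hornerX hornerC.
  by rewrite e subrr.
have Pb : P.[b] = 0.
  have := congr1 (horner^~ 0) e'; rewrite horner_comp hornerZ L0 mulr0.
  by rewrite hornerD hornerZ hornerX mulr0 add0r hornerC.
split=> //; rewrite -e' /comp_poly (lin_add hP) -[X in _ = _ + X]/(P \Po b%:P).
by rewrite comp_polyCr Pb polyC0 addr0.
Qed.

Lemma coef_comp_scale (K : fieldType) (P : {poly K}) a i :
  (P \Po (a *: 'X))`_i = P`_i * a ^+ i.
Proof.
rewrite comp_polyE coef_sum; have [iP|Pi] := ltnP i (size P).
  rewrite (bigD1 (Ordinal iP)) //= exprZn !coefZ coefXn eqxx mulr1 big1 ?addr0 //.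
  move=> j ji; rewrite exprZn !coefZ coefXn eq_sym.
  by move: ji; rewrite -val_eqE /= => /negPf ->; rewrite !mulr0.
rewrite nth_default // mul0r big1 // => j _; rewrite exprZn !coefZ coefXn.
by rewrite gtn_eqF ?mulr0 // (leq_trans _ Pi).
Qed.

(* The exponents [k] with [a ^ (r ^ k) = a] are the multiples of the least
   positive one; if this were at least 2, both polynomials would be linearized
   for a proper power of [r]. *)
Lemma common_fixed_exponent (K : fieldType) (r : nat) (L1 L2 : {poly K}) (a : K) j0 :
    (1 < r)%N -> linearized r L1 -> linearized r L2 ->
    (forall k, (2 <= k)%N -> ~ (linearized (r ^ k) L1 /\ linearized (r ^ k) L2)) ->
    (0 < j0)%N -> L1`_(r ^ j0) != 0 ->
    (forall i, L1`_i != 0 -> a ^+ i = a) -> (forall i, L2`_i != 0 -> a ^+ i = a) ->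
  a ^+ r = a.
Proof.
move=> r1 lin1 lin2 hmax j0pos Lj0 a1 a2.
have ex : exists k, (0 < k)%N && (a ^+ (r ^ k) == a).
  by exists j0; rewrite j0pos a1 ?eqxx.
have [g /andP [g0 /eqP ag] gmin] := ex_minnP ex.
have ag' k : a ^+ (r ^ (g * k)) = a.
  elim: k => [|k IH]; first by rewrite muln0.
  by rewrite mulnS expnD exprM ag IH.
have dvdg k : a ^+ (r ^ k) = a -> (g %| k)%N.
  move=> ak; apply: contraT => ngk.
  have ake : a ^+ (r ^ (k %% g)) = a.
    by rewrite -{2}ak {2}(divn_eq k g) [(_ %/ _ * _)%N]mulnC expnD exprM ag'.
  have := gmin (k %% g)%N; rewrite lt0n -/(dvdn g k) ngk ake eqxx.
  by rewrite leqNgt ltn_mod g0 => /(_ isT).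
have lin L : linearized r L -> (forall i, L`_i != 0 -> a ^+ i = a) -> linearized (r ^ g) L.
  move=> linL aL; apply: coef_linearized => [|i Li].
    by rewrite -(exp1n g) ltn_exp2r.
  have [k ik] := linearized_coef linL Li.
  have /dvdnP [l kl] : (g %| k)%N by apply: dvdg; rewrite -ik aL.
  by exists l; rewrite ik kl -expnM mulnC.
have [g2|] := leqP 2 g; first by case: (hmax g g2); split; apply: lin.
by rewrite ltnS leq_eqVlt ltnNge g0 orbF => /eqP g1; rewrite -{2}ag g1 expn1.
Qed.

Lemma transc_nonconst (K F : fieldType) (iota : {rmorphism K -> F}) u (P : {poly K}) c :
  transc iota u -> (1 < size P)%N -> (map_poly iota P).[u] <> iota c.
Proof.
move=> tu sP e; have : P - c%:P = 0.
  by apply: tu; rewrite rmorphB /= map_polyC hornerD hornerN hornerC e subrr.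
move/eqP; rewrite subr_eq0 => /eqP PE; move: sP.
by rewrite PE ltnNge size_polyC_leq1.
Qed.

Lemma fixed_comp (K : fieldType) (L : {poly K}) d :
  (forall i, L`_i != 0 -> d ^+ i = d) -> L \Po (d *: 'X) = d *: L.
Proof.
move=> hd; apply/polyP => i; rewrite coef_comp_scale coefZ mulrC.
by have [->|/hd ->] := eqVneq L`_i 0; rewrite ?mulr0.
Qed.

Lemma fixed_hornerF (K F : fieldType) (iota : {rmorphism K -> F}) (L : {poly K}) d z :
    (forall i, L`_i != 0 -> d ^+ i = d) ->
  (map_poly iota L).[iota d * z] = iota d * (map_poly iota L).[z].
Proof.
move=> /fixed_comp /(congr1 (fun P : {poly K} => (map_poly iota P).[z])).
by rewrite /= map_comp_poly horner_comp !linearZ /= map_polyX !hornerZ hornerX.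
Qed.

Lemma fixed_horner (K : fieldType) (L : {poly K}) d z :
  (forall i, L`_i != 0 -> d ^+ i = d) -> L.[d * z] = d * L.[z].
Proof.
move=> /fixed_comp /(congr1 (horner^~ z)).
by rewrite horner_comp !hornerZ hornerX.
Qed.

(** * Automorphisms as affine maps *)

Section AutClassification.
Variables (K : closedFieldType) (F : fieldType) (iota : {rmorphism K -> F}).
Variables (q : nat) (L1 L2 : {poly K}) (x y : F).
Hypothesis hC : curve iota q L1 L2 x y.
Hypothesis frobenius : forall a b : {poly K}, (a + b) ^+ q = a ^+ q + b ^+ q.
Hypothesis hneq : ~ scaling_equivalent L1 L2.
Local Notation "P .@[ z ]" := (map_poly iota P).[z] (at level 2, format "P .@[ z ]").

Lemma aut_affine (s : {rmorphism F -> F}) : is_curve_aut iota s ->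
  exists a b c, [/\ [/\ a != 0, L1.[b] = 0 & L2.[c] = 0],
    s x = iota a * x + iota b, s y = iota a^-1 * y + iota c,
    forall i, L1`_i != 0 -> a ^+ i = a & forall i, L2`_i != 0 -> a ^+ i = a].
Proof.
move=> hs; have [_ sK] := hs.
have hC' := curve_swap hC; have hL1 := curve_lin1 hC; have hL2 := curve_lin2 hC.
have q2 := curve_q hC.
have tx : transc iota x := curve_transc hC; have ty : transc iota y := curve_transc hC'.
have ts z : transc iota z -> transc iota (s z).
  move=> tz A; rewrite -(rmorph_horner _ _ sK) => /eqP.
  by rewrite fmorph_eq0 => /eqP /tz.
have huv : L1.@[s x] * L2.@[s y] = 1.
  by rewrite -!(rmorph_horner _ _ sK) -rmorphM (curve_eq hC) rmorph1.
have prod1 c c' : L1.@[x] * L2.@[y] = (iota c * L1.@[x]) * (iota c' * L2.@[y]) -> c * c' = 1.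
  move=> e; apply: (fmorph_inj iota); rewrite rmorphM rmorph1 -(curve_eq hC) e.
  by rewrite mulrACA (curve_eq hC) mulr1.
have [l1 l2] := (lin_coef1 hL1, lin_coef1 hL2).
case: (aut_pencils hC hs) => -[].
  move=> xu ux yv vy.
  have [C1 [D1 [sC1 sD1 D10 uE]]] := mutually_rational_size tx (ts _ tx) xu ux.
  have [C2 [D2 [sC2 sD2 D20 vE]]] := mutually_rational_size ty (ts _ ty) yv vy.
  have [||c|a [b [a' [b' [c [c' [sx sy c0 e1 e2]]]]]]] := mobius_solution hC frobenius
    _ _ sC1 sD1 sC2 sD2 D10 D20 uE vE huv.
  - by rewrite (lin_size hL1).
  - by rewrite (lin_size hL2).
  - by apply: transc_nonconst; [apply: ts | rewrite (lin_size hL1) ltnS ltnW // ltnW].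
  have cc' : c * c' = 1 by apply: prod1; rewrite -e1 -e2 huv (curve_eq hC).
  rewrite sx in e1; rewrite sy in e2.
  have [Lb /polyP f1] := lin_poly_comp tx hL1 (lin0 hL1) e1.
  have [Lb' /polyP f2] := lin_poly_comp ty hL2 (lin0 hL2) e2.
  (* The coefficient of degree 1 identifies slope and factor. The other coefficients then give
     [a ^+ i = a], and [c * c' = 1] gives the inverse slope on [y]. *)
  have ac : a = c.
    by have := f1 1%N; rewrite coef_comp_scale coefZ expr1 mulrC => /(mulIf l1).
  have ac' : a' = c'.
    by have := f2 1%N; rewrite coef_comp_scale coefZ expr1 mulrC => /(mulIf l2).
  have a0 : a != 0 by rewrite ac.
  have a'E : a' = a^-1 by apply: (mulfI a0); rewrite mulfV // ac ac'.
  exists a, b, b'; split=> //; first by rewrite -a'E.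
    by move=> i Li; have := f1 i; rewrite coef_comp_scale coefZ -ac mulrC => /(mulIf Li).
  move=> i Li; have := f2 i; rewrite coef_comp_scale coefZ -ac' a'E mulrC => /(mulIf Li).
  by rewrite exprVn => /invr_inj.
(* Swapped rulings: [s x = a' y + b'] and [L1(s x) = c' L2(y)] yield [L2(T) = c'^-1 L1(a' T)], the
   excluded scaling equivalence. *)
move=> xu ux yv vy.
have [C1 [D1 [sC1 sD1 D10 uE]]] := mutually_rational_size tx (ts _ ty) xu ux.
have [C2 [D2 [sC2 sD2 D20 vE]]] := mutually_rational_size ty (ts _ tx) yv vy.
have hvu : L2.@[s y] * L1.@[s x] = 1 by rewrite mulrC.
have [||c|a [b [a' [b' [c [c' [sy sx c0 e1 e2]]]]]]] := mobius_solution hC frobenius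
  _ _ sC1 sD1 sC2 sD2 D10 D20 uE vE hvu.
- by rewrite (lin_size hL2).
- by rewrite (lin_size hL1).
- by apply: transc_nonconst; [apply: ts | rewrite (lin_size hL2) ltnS ltnW // ltnW].
have cc' : c * c' = 1 by apply: prod1; rewrite -e1 -e2 hvu (curve_eq hC).
have [_ c'0] := mul_eq1_neq0 cc'.
rewrite sx in e2.
have [_ f2] := lin_poly_comp ty hL1 (lin0 hL2) e2.
case: hneq; exists c'^-1, a'; split; rewrite ?invr_eq0 //.
  apply: contraNneq l2 => a'0; have := congr1 (fun p : {poly K} => p`_1) f2.
  by rewrite coef_comp_scale coefZ a'0 expr1 mulr0 => /esym/eqP; rewrite mulf_eq0 (negPf c'0).
by rewrite f2 scalerA mulVf // scale1r.
Qed.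

Lemma affine_aut (a b c : K) : a != 0 -> L1.[b] = 0 -> L2.[c] = 0 ->
    (forall i, L1`_i != 0 -> a ^+ i = a) -> (forall i, L2`_i != 0 -> a ^+ i = a) ->
  {s : {rmorphism F -> F} | [/\ forall k, s (iota k) = iota k,
     s x = iota a * x + iota b & s y = iota a^-1 * y + iota c]}.
Proof.
move=> a0 Lb Lc a1 a2.
apply: (curve_affine_morph hC a0); first by rewrite invr_eq0.
move=> u v; rewrite (lin_addF (curve_lin1 hC)) (lin_addF (curve_lin2 hC)).
rewrite !horner_iota Lb Lc rmorph0 !addr0 (fixed_hornerF _ _ a1) fixed_hornerF; last first.
  by move=> i /a2 ai; rewrite exprVn ai.
have ia0 : iota a != 0 by rewrite fmorph_eq0.
by rewrite mulrACA -rmorphM mulfV // rmorph1 mul1r.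
Qed.

Lemma affine_is_aut (a b c : K) (s : {rmorphism F -> F}) :
    a != 0 -> L1.[b] = 0 -> L2.[c] = 0 ->
    (forall i, L1`_i != 0 -> a ^+ i = a) -> (forall i, L2`_i != 0 -> a ^+ i = a) ->
    [/\ forall k, s (iota k) = iota k, s x = iota a * x + iota b
      & s y = iota a^-1 * y + iota c] ->
  is_curve_aut iota s.
Proof.
move=> a0 Lb Lc a1 a2 [sK sx sy]; split=> //.
have aV0 : a^-1 != 0 by rewrite invr_eq0.
have inv1 : forall i, L1`_i != 0 -> a^-1 ^+ i = a^-1.
  by move=> i /a1 ai; rewrite exprVn ai.
have inv2 : forall i, L2`_i != 0 -> a^-1 ^+ i = a^-1.
  by move=> i /a2 ai; rewrite exprVn ai.
have [||t [tK tx ty]] := @affine_aut a^-1 (- (a^-1 * b)) (- (a * c)) aV0 _ _ inv1 inv2.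
- by rewrite (linN (curve_lin1 hC)) fixed_horner // Lb mulr0 oppr0.
- by rewrite (linN (curve_lin2 hC)) fixed_horner // Lc mulr0 oppr0.
have ia0 : iota a != 0 by rewrite fmorph_eq0.
rewrite invrK in ty.
have aut_id (g : {rmorphism F -> F}) : (forall k, g (iota k) = iota k) ->
    g x = x -> g y = y -> g =1 idfun.
  by move=> gK gx gy; apply: (curve_morph_eq hC (t := idfun)).
have stK : (s \o t : {rmorphism F -> F}) =1 idfun.
  apply: aut_id => [k||] /=; first by rewrite tK sK.
    rewrite tx rmorphD rmorphM !sK sx rmorphN rmorphM fmorphV; by field.
  rewrite ty rmorphD rmorphM !sK sy rmorphN rmorphM fmorphV; by field.
have tsK : (t \o s : {rmorphism F -> F}) =1 idfun.
  apply: aut_id => [k||] /=; first by rewrite sK tK.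
    rewrite sx rmorphD rmorphM !tK tx rmorphN rmorphM fmorphV; by field.
  rewrite sy rmorphD rmorphM !tK ty rmorphN rmorphM fmorphV; by field.
by exists t => z; [apply: tsK | apply: stK].
Qed.

End AutClassification.

(** * The automorphism group *)

Section GroupOn.
Variables (T : finType) (mul : T -> T -> T) (one : T) (inv : T -> T).
Hypothesis (mulA : associative mul) (mul1 : left_id one mul).
Hypothesis mulV : left_inverse one inv mul.

(** A copy of [T] whose type mentions the proofs of the laws, so that a group structure can be
    attached to it by instance. *)
Definition group_on of associative mul & left_id one mul &
  left_inverse one inv mul : Type := T.

HB.instance Definition _ := Finite.on (group_on mulA mul1 mulV).
HB.instance Definition _ :=
  Finite_isGroup.Build (group_on mulA mul1 mulV) mulA mul1 mulV.

End GroupOn.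

(** Composition is transported to the parameter type. The parameter of an automorphism is found by
    [xchoose], for which comparing the images of [x] and [y] is a decidable test. *)
Lemma finite_full_aut_group (K F : fieldType) (iota : {rmorphism K -> F})
    (T : finType) (act : T -> {rmorphism F -> F}) (x y : F) :
    (forall t, is_curve_aut iota (act t)) ->
    (forall s, is_curve_aut iota s -> exists t, act t =1 s) ->
    injective (fun t => (act t x, act t y)) ->
    (forall s t : {rmorphism F -> F}, is_curve_aut iota s -> is_curve_aut iota t ->
       s x = t x -> s y = t y -> s =1 t) ->
  exists (gT : finGroupType) (phi : T -> gT) (act' : gT -> {rmorphism F -> F}),
    [/\ bijective phi, forall t, act' (phi t) = act t & is_full_aut_group iota act'].
Proof.
move=> hact hfull hinj hsep.
have inj t u : act t =1 act u -> t = u.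
  by move=> e; apply: hinj; rewrite !e.
have find s : is_curve_aut iota s -> {t | act t =1 s}.
  move=> hs; have ex : exists t, (act t x == s x) && (act t y == s y).
    by have [t ts] := hfull s hs; exists t; rewrite !ts !eqxx.
  by exists (xchoose ex); have /andP [/eqP ? /eqP ?] := xchooseP ex; apply: hsep.
have compP g h : is_curve_aut iota (act g \o act h : {rmorphism F -> F}).
  have [bg gK] := hact g; have [bh hK] := hact h.
  by split; [apply: bij_comp | move=> c; rewrite /= hK gK].
have idP : is_curve_aut iota (idfun : {rmorphism F -> F}).
  by split=> //; exists idfun.
have invP g : {t : {rmorphism F -> F} | is_curve_aut iota t & t \o act g =1 idfun}.
  have [bg gK] := hact g.
  have inj_g : injective (act g) := fmorph_inj (act g).
  (* [bijective] is a proposition and yields no inverse function; preimages are selected through the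
     decidable equality of [F]. *)
  have ex z : exists w, act g w == z.
    by case: bg => k _ kK; exists (k z); rewrite kK.
  pose k z := xchoose (ex z).
  have kK : cancel k (act g) by move=> z; apply/eqP/(xchooseP (ex z)).
  have Kk : cancel (act g) k by move=> z; apply: inj_g; rewrite kK.
  have [t tE] := rmorph_inverse Kk kK.
  exists t; last by move=> z /=; rewrite tE Kk.
  split; first by exists (act g) => z; rewrite tE ?kK ?Kk.
  by move=> c; rewrite tE -{1}(gK c) Kk.
pose mul g h := sval (find _ (compP g h)).
pose one := sval (find _ idP).
pose inv g := sval (find _ (s2valP (invP g))).
have mulE g h : act (mul g h) =1 act g \o act h by rewrite /mul; case: (find _ _).
have oneE : act one =1 idfun by rewrite /one; case: (find _ _).
have invE g : act (inv g) \o act g =1 idfun.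
  move=> z /=; rewrite /inv; case: (find _ _) => t /= ->.
  by case: (invP g) => t' /= _ /(_ z).
have mulA : associative mul.
  by move=> g h k; apply: inj => z; rewrite !mulE /= !mulE.
have mul1 : left_id one mul by move=> g; apply: inj => z; rewrite mulE /= oneE.
have mulV : left_inverse one inv mul.
  by move=> g; apply: inj => z; rewrite mulE oneE; apply: invE.
exists (group_on mulA mul1 mulV), id, act; split=> //; first by exists id.
Qed.

Section AutGroup.
Variables (K : closedFieldType) (F : fieldType) (iota : {rmorphism K -> F}).
Variables (q : nat) (L1 L2 : {poly K}) (x y : F).
Hypothesis hC : curve iota q L1 L2 x y.
Variables (k : nat) (lambda : K).
Hypothesis k1 : (1 < k)%N.
Hypothesis prim : k.-primitive_root lambda.
Hypothesis fixed1 : forall e i, L1`_i != 0 -> (lambda ^+ e) ^+ i = lambda ^+ e.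
Hypothesis fixed2 : forall e i, L2`_i != 0 -> (lambda ^+ e) ^+ i = lambda ^+ e.
Hypothesis aut_param : forall s : {rmorphism F -> F}, is_curve_aut iota s ->
  exists e b c, [/\ L1.[b] = 0, L2.[c] = 0, s x = iota (lambda ^+ e) * x + iota b
                  & s y = iota (lambda ^+ e)^-1 * y + iota c].

Let hL1 := curve_lin1 hC.
Let hL2 := curve_lin2 hC.
Let r1 := roots2 (curve_swap hC).
Let r2 := roots2 hC.

Let k0 : (0 < k)%N := ltnW k1.

Let lambda_exp_neq0 e : lambda ^+ e != 0.
Proof.
rewrite expf_neq0 //; apply: contra_eq_neq (prim_expr_order prim) => ->.
by rewrite expr0n (gtn_eqF k0) eq_sym oner_neq0.
Qed.

Let root1 (b : seq_sub r1) : L1.[ssval b] = 0.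
Proof. by apply/eqP; rewrite -(mem_roots2 (curve_swap hC)) (ssvalP b). Qed.

Let root2 (c : seq_sub r2) : L2.[ssval c] = 0.
Proof. by apply/eqP; rewrite -(mem_roots2 hC) (ssvalP c). Qed.

(** The triple [(b, c, e)] stands for [X -> lambda^e X + b], [Y -> lambda^-e Y + c]. *)
Let param := (seq_sub r1 * seq_sub r2 * 'I_k)%type.

Let param_act (t : param) : {rmorphism F -> F} :=
  sval (affine_aut hC (lambda_exp_neq0 t.2) (root1 t.1.1) (root2 t.1.2) (fixed1 t.2) (fixed2 t.2)).

Let is_affine (s : F -> F) (a b c : K) :=
  s x = iota a * x + iota b /\ s y = iota a^-1 * y + iota c.

Let param_actP t :
  is_curve_aut iota (param_act t) /\
  is_affine (param_act t) (lambda ^+ t.2) (ssval t.1.1) (ssval t.1.2).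
Proof.
rewrite /param_act; case: affine_aut => s /= hs; have [sK sx sy] := hs; split=> //.
exact: (affine_is_aut hC (lambda_exp_neq0 _) (root1 _) (root2 _) (fixed1 _) (fixed2 _) hs).
Qed.

Lemma transc_affine_inj z (a b a' b' : K) : transc iota z ->
  iota a * z + iota b = iota a' * z + iota b' -> a = a' /\ b = b'.
Proof.
move=> tz e; have : (a - a') *: 'X + (b - b')%:P = 0.
  apply: tz; rewrite rmorphD /= linearZ /= map_polyX map_polyC.
  rewrite hornerD hornerZ hornerX hornerC !rmorphB.
  by transitivity (iota a * z + iota b - (iota a' * z + iota b')); [ring | rewrite e subrr].
move=> P0; split; apply/eqP; rewrite -subr_eq0.
  have := congr1 (fun P : {poly K} => P`_1) P0.
  by rewrite coef0 coefD coefZ coefX coefC mulr1 addr0 => ->.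
have := congr1 (fun P : {poly K} => P`_0) P0.
by rewrite coef0 coefD coefZ coefX coefC mulr0 add0r => ->.
Qed.

Let affine_inj s a b c a' b' c' : is_affine s a b c -> is_affine s a' b' c' ->
  [/\ a = a', b = b' & c = c'].
Proof.
case=> sx sy [sx' sy']; rewrite sx in sx'; rewrite sy in sy'.
have [-> ->] := transc_affine_inj (curve_transc hC) sx'.
by have [_ ->] := transc_affine_inj (curve_transc (curve_swap hC)) sy'.
Qed.

Let aut_sep (s t : {rmorphism F -> F}) : is_curve_aut iota s -> is_curve_aut iota t ->
  s x = t x -> s y = t y -> s =1 t.
Proof. by case=> _ sK [_ tK]; apply: (curve_morph_eq hC). Qed.

Let param_full (s : {rmorphism F -> F}) : is_curve_aut iota s ->
  exists t, param_act t =1 s.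
Proof.
move=> hs; have [e [b [c [Lb Lc sx sy]]]] := aut_param hs.
have br : b \in r1 by rewrite mem_roots2 Lb.
have cr : c \in r2 by rewrite mem_roots2 Lc.
exists (SeqSub br, SeqSub cr, Ordinal (ltn_pmod e k0)).
have [hact [ax ay]] := param_actP (SeqSub br, SeqSub cr, Ordinal (ltn_pmod e k0)).
have ek : lambda ^+ (e %% k) = lambda ^+ e by rewrite (prim_expr_mod prim).
by apply: aut_sep; rewrite // ?ax ?ay /= ek.
Qed.

Let param_inj : injective (fun t => (param_act t x, param_act t y)).
Proof.
move=> [[b c] i] [[b' c'] j] [ex ey].
have [_ [ax ay]] := param_actP (b, c, i); have [_ [ax' ay']] := param_actP (b', c', j).
have hj : is_affine (param_act (b, c, i)) (lambda ^+ j) (ssval b') (ssval c').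
  by split; [rewrite ex ax' | rewrite ey ay'].
have [/eqP ij bb cc] := affine_inj (conj ax ay) hj.
congr (_, _, _); apply/val_inj => //; move: ij; rewrite /= (eq_prim_root_expr prim).
by rewrite !modn_small // => /eqP.
Qed.

Theorem curve_aut_group (p : nat) : prime p -> p \in [pchar K] ->
  exists (gT : finGroupType) (act : gT -> {rmorphism F -> F})
         (Sigma Gamma : {group gT}) (theta : gT),
    [/\ is_full_aut_group iota act,
        (Sigma ><| Gamma)%g = [set: gT],
        [/\ forall g, g \in Sigma <->
              exists alpha beta, [/\ L1.[alpha] = 0, L2.[beta] = 0
                                   & is_tau iota x y alpha beta (act g)],
            forall alpha beta, L1.[alpha] = 0 -> L2.[beta] = 0 ->
              exists2 g, g \in Sigma & is_tau iota x y alpha beta (act g),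
            (p.-abelem Sigma)%g
          & #|Sigma| = (q ^ 2)%N]
      & [/\ Gamma = <[theta]>%g :> {set gT},
            is_theta iota x y lambda (act theta)
          & #|Gamma| = k]].
Proof.
move=> hp pK.
have [gT [phi [act [bij_phi actE full]]]] := finite_full_aut_group
  (fun t => proj1 (param_actP t)) param_full param_inj aut_sep.
exists gT, act; have [gaut gex ginj gmul] := full.
have [psi phiK psiK] := bij_phi.
pose E g := lambda ^+ (psi g).2; pose A g := ssval (psi g).1.1; pose B g := ssval (psi g).1.2.
have gP g : is_affine (act g) (E g) (A g) (B g).
  by rewrite -{1}[g]psiK actE; case: (param_actP (psi g)).
have LA g : L1.[A g] = 0 by apply: root1.
have LB g : L2.[B g] = 0 by apply: root2.
have E0 g : E g != 0 by apply: lambda_exp_neq0.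
have actK g c : act g (iota c) = iota c by case: (gaut g).
have ext g h : E g = E h -> A g = A h -> B g = B h -> g = h.
  move=> e1 e2 e3; apply: ginj; have [gx gy] := gP g; have [hx hy] := gP h.
  by apply: aut_sep; rewrite ?gx ?gy ?hx ?hy ?e1 ?e2 ?e3.
(* The order matters: [act g] is applied to [act h x = E h x + A h], so the slope of [h] multiplies
   the translation part of [g]. *)
have mulP g h : [/\ E (g * h)%g = E g * E h, A (g * h)%g = E h * A g + A h
                  & B (g * h)%g = (E h)^-1 * B g + B h].
  apply: (affine_inj (gP _)); have [gx gy] := gP g; have [hx hy] := gP h.
  split; rewrite gmul /= ?hx ?hy rmorphD rmorphM !actK ?gx ?gy !rmorphD !rmorphM.
    by ring.
  by rewrite !fmorphV rmorphM; field; rewrite !fmorph_eq0 !E0.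
have oneP : [/\ E 1%g = 1, A 1%g = 0 & B 1%g = 0].
  have [e1 e2 e3] := mulP 1%g 1%g; rewrite mulg1 in e1 e2 e3.
  have E1 : E 1%g = 1 by apply: (mulfI (E0 1%g)); rewrite -e1 mulr1.
  split=> //; first by apply: (addrI (A 1%g)); rewrite addr0 [RHS]e2 E1 mul1r.
  by apply: (addrI (B 1%g)); rewrite addr0 [RHS]e3 E1 invr1 mul1r.
have [E1 A1 B1] := oneP.
have surj e b c : L1.[b] = 0 -> L2.[c] = 0 ->
    exists g, [/\ E g = lambda ^+ e, A g = b & B g = c].
  move=> Lb Lc; have [s hs] := affine_aut hC (lambda_exp_neq0 e) Lb Lc (fixed1 e) (fixed2 e).
  have [g gs] := gex s (affine_is_aut hC (lambda_exp_neq0 e) Lb Lc (fixed1 e) (fixed2 e) hs).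
  exists g; apply: (affine_inj (gP g)); case: hs => _ sx sy.
  by split; rewrite gs.
have tauP g b c : is_tau iota x y b c (act g) <-> [/\ E g = 1, A g = b & B g = c].
  split=> [[gx gy]|[e1 e2 e3]].
    apply: (affine_inj (gP g)); split; first by rewrite gx rmorph1 mul1r.
    by rewrite gy invr1 rmorph1 mul1r.
  have [gx gy] := gP g; rewrite e1 e2 e3 in gx gy.
  by split; rewrite ?gx ?gy ?invr1 rmorph1 mul1r.
(* [Sigma] is taken as the kernel of the character [E]. *)
have grpS : group_set [set g | E g == 1].
  apply/group_setP; split; first by rewrite inE E1.
  move=> g h; rewrite !inE => /eqP eg /eqP eh; have [-> _ _] := mulP g h.
  by rewrite eg eh mulr1.
have [theta [tE tA tB]] := surj 1%N 0 0 (lin0 hL1) (lin0 hL2).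
rewrite expr1 in tE.
have tX i : [/\ E (theta ^+ i)%g = lambda ^+ i, A (theta ^+ i)%g = 0
             & B (theta ^+ i)%g = 0].
  elim: i => [|i [ei ai bi]]; first by rewrite expg0.
  rewrite expgSr; have [-> -> ->] := mulP (theta ^+ i)%g theta.
  by rewrite ei ai bi tE tA tB !mulr0 !addr0 exprSr.
have EV g : E g^-1%g * E g = 1 by have [<- _ _] := mulP g^-1%g g; rewrite mulVg.
pose S : {group gT} := Group grpS.
have inS g : (g \in S) = (E g == 1) by rewrite inE.
exists S, <[theta]>%G, theta; split=> //.
- rewrite sdprodE; last 1 first.
  + apply/trivgP/subsetP => g; rewrite inE inS => /andP [/eqP gE /cycleP [i gi]].
    rewrite inE; apply/eqP; have [ei ai bi] := tX i; rewrite -gi in ei ai bi.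
    by apply: ext; rewrite ?gE ?ai ?bi.
  + apply/setP => g; rewrite [RHS]inE; apply/mulsgP.
    (* [theta] to the exponent of [g] has the same slope as [g], so the quotient is a
       translation. *)
    exists (g * theta ^- (psi g).2)%g (theta ^+ (psi g).2)%g.
    * rewrite inS; have [-> _ _] := mulP g (theta ^- (psi g).2)%g; apply/eqP.
      have := EV (theta ^+ (psi g).2)%g; have [-> _ _] := tX (psi g).2.
      by rewrite mulrC.
    * exact: mem_cycle.
    by rewrite mulgKV.
  + apply/subsetP => h _; rewrite inE; apply/subsetP => _ /imsetP [g + ->]; rewrite inS => /eqP gE.
    rewrite inS /conjg; have [-> _ _] := mulP h^-1%g (g * h)%g.
    by have [-> _ _] := mulP g h; rewrite gE mul1r EV.
- split.
  + move=> g; rewrite inS; split=> [/eqP gE|[b [c [_ _ /tauP [-> _ _]]]]] //.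
    by exists (A g), (B g); split=> //; apply/tauP.
  + move=> b c Lb Lc; have [g [ge gb gc]] := surj 0%N b c Lb Lc.
    by exists g; [rewrite inS ge | apply/tauP].
  + rewrite abelemE //; apply/andP; split.
      apply/centsP => g; rewrite inS => /eqP gE h; rewrite inS => /eqP hE.
      have [e1 e2 e3] := mulP g h; have [e1' e2' e3'] := mulP h g.
      apply: ext; rewrite ?e1 ?e1' ?e2 ?e2' ?e3 ?e3' gE hE //.
        by rewrite !mul1r addrC.
      by rewrite invr1 !mul1r addrC.
    apply/exponentP => g; rewrite inS => /eqP gE.
    have gX i : [/\ E (g ^+ i)%g = 1, A (g ^+ i)%g = A g *+ i & B (g ^+ i)%g = B g *+ i].
      elim: i => [|i [ei ai bi]]; first by rewrite expg0 !mulr0n.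
      rewrite expgSr; have [-> -> ->] := mulP (g ^+ i)%g g.
      by rewrite ei ai bi gE invr1 !mul1r !mulrSr.
    have [ep ap bp] := gX p.
    by apply: ext; rewrite ?ep ?ap ?bp // -mulr_natr (pcharf0 pK) mulr0.
  (* The translations are the triples with exponent 0, so they are counted by pairs of roots. *)
  pose f (bc : seq_sub r1 * seq_sub r2) := phi (bc, Ordinal k0).
  have -> : S = f @: setT :> {set gT}.
    apply/setP => g; rewrite inS; apply/eqP/imsetP => [gE|[bc _ ->]].
      exists (psi g).1; rewrite ?inE // /f; apply: (can_inj psiK).
      rewrite phiK [LHS]surjective_pairing; congr (_, _); apply/val_inj => /=.
      have : (k %| (psi g).2)%N by rewrite (prim_order_dvd prim) -/(E g) gE.
      by rewrite /dvdn modn_small // => /eqP.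
    by rewrite /E /f phiK expr0.
  rewrite card_imset; last by move=> bc bc' /(can_inj phiK) [->].
  rewrite cardsT card_prod !card_seq_sub ?roots2_uniq // !roots2_size.
  by rewrite mulnn.
split=> //.
  have [gx gy] := gP theta; rewrite tE tA tB in gx gy.
  by split; rewrite ?gx ?gy rmorph0 addr0.
apply/eqP; rewrite -[#|_|]/#[theta]%g eqn_dvd order_dvdn; apply/andP; split.
  have [ek ak bk] := tX k; apply/eqP/ext; rewrite ?ek ?ak ?bk //.
  by rewrite (prim_expr_order prim).
rewrite (prim_order_dvd prim).
have [<- _ _] := tX #[theta]%g; rewrite expg_order E1 //.
Qed.

End AutGroup.

Unset Implicit Arguments.

Theorem theorem1p2 (p n m : nat) (hp : prime p) (hodd : odd p)
    (hn : (0 < n)%N) (hm : (0 < m)%N)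
    (qbar q : nat) (hqbar : qbar = (p ^ n)%N) (hq : q = (qbar ^ m)%N)
    (K : closedFieldType) (emb : {rmorphism 'F_p -> K})
    (hK : forall z : K, algebraicOver emb z)
    (L1 L2 : {poly K})
    (hsep1 : separable_poly L1) (hsep2 : separable_poly L2)
    (hlin1 : linearized qbar L1) (hlin2 : linearized qbar L2)
    (hdeg1 : size L1 = q.+1) (hdeg2 : size L2 = q.+1)
    (hmax : forall k : nat, (2 <= k)%N ->
        ~ (linearized (qbar ^ k) L1 /\ linearized (qbar ^ k) L2))
    (hneq : ~ scaling_equivalent L1 L2)
    (F : fieldType) (iota : {rmorphism K -> F}) (x y : F)
    (hF : is_function_field iota (curve_poly L1 L2) x y)
    (lambda : K) (hlambda : (qbar.-1).-primitive_root lambda) :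
  exists (gT : finGroupType) (act : gT -> {rmorphism F -> F})
         (Sigma Gamma : {group gT}) (theta : gT),
    [/\ is_full_aut_group iota act,
        (Sigma ><| Gamma)%g = [set: gT],
        [/\ forall g, g \in Sigma <->
              exists alpha beta, [/\ L1.[alpha] = 0, L2.[beta] = 0
                                   & is_tau iota x y alpha beta (act g)],
            forall alpha beta, L1.[alpha] = 0 -> L2.[beta] = 0 ->
              exists2 g, g \in Sigma & is_tau iota x y alpha beta (act g),
            (p.-abelem Sigma)%g
          & #|Sigma| = (q ^ 2)%N]
      & [/\ Gamma = <[theta]>%g :> {set gT},
            is_theta iota x y lambda (act theta)
          & #|Gamma| = qbar.-1]].
Proof.
have p3 : (2 < p)%N by rewrite ltn_neqAle prime_gt1 // andbT; case: eqP hodd => [<-|].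
have qbar3 : (2 < qbar)%N.
  by rewrite hqbar (leq_trans p3) // -{1}(expn1 p) leq_exp2l // ltnW.
have q3 : (2 < q)%N.
  by rewrite hq (leq_trans qbar3) // -{1}(expn1 qbar) leq_exp2l // ltnW.
have q0 : (0 < q)%N := ltnW (ltnW q3).
have pK : p \in [pchar K] := pchar_emb hp emb (idfun : {rmorphism K -> K}).
have linp (L : {poly K}) : separable_poly L -> linearized qbar L -> size L = q.+1 -> lin_poly q L.
  by move=> sepL linL sL; apply: (linearized_lin_poly hp hn emb); rewrite -?hqbar.
have hC : curve iota q L1 L2 x y by split=> //; apply: linp.
have frob (a b : {poly K}) : (a + b) ^+ q = a ^+ q + b ^+ q.
  by rewrite hq hqbar -expnM (pchar_frobenius hp emb (@polyC K)).
have fixed (L : {poly K}) : linearized qbar L ->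
    forall e i, L`_i != 0 -> (lambda ^+ e) ^+ i = lambda ^+ e.
  move=> linL e i /(linearized_coef linL) [j ->].
  have le : (lambda ^+ e) ^+ qbar = lambda ^+ e.
    rewrite -[in LHS](ltn_predK qbar3) exprSr -exprM mulnC exprM.
    by rewrite (prim_expr_order hlambda) expr1n mul1r.
  by elim: j => [|j IH]; rewrite ?expr1 // expnSr exprM IH.
apply: (curve_aut_group hC (lambda := lambda)) => //.
- by rewrite -ltnS (ltn_predK qbar3).
- exact: fixed.
- exact: fixed.
move=> s hs; have [a [b [c [[a0 Lb Lc] sx sy a1 a2]]]] := aut_affine hC frob hneq hs.
have aq : a ^+ qbar = a.
  (* The leading coefficient of [L1], of degree [q = qbar^m] with [m > 0], supplies the required
     positive exponent. *)
  apply: (@common_fixed_exponent _ _ L1 L2 _ m) => //; first exact: ltnW.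
  by rewrite -hq -[q]/(q.+1.-1) -hdeg1 -lead_coefE lead_coef_eq0 -size_poly_eq0 hdeg1.
(* Since [a] is nonzero, [a ^+ qbar = a] makes it a root of unity of order dividing [qbar - 1],
   hence a power of [lambda]. *)
have [|e ae] := prim_rootP hlambda (x := a).
  by apply: (mulfI a0); rewrite mulr1 -exprS (ltn_predK qbar3).
by exists e, b, c; rewrite -ae.
Qed.
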